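(* Let $p$ satisfy (H$_p$) and let $\varrho_0\in L^\infty(\mathbb{T}^d)$, $\varrho_0\ge0$. For every $T>0$ there exists a unique solution $(\eta,\sigma)\in L^\infty([0,T]\times\mathbb{T}^d)\times L^\infty([0,T]\times\mathbb{T}^d)$ of the Lagrangian system (L) with $\eta(0,y)=\varrho_0(y)$. Moreover, there is a constant $r$, independent of $T$, such that $\|\eta\|_{L^\infty([0,T]\times\mathbb{T}^d)}\le r$.
   Context: Assumption (H$_p$): $p:[0,\infty)\to\mathbb{R}$ is $C^1$, unbounded above, and there are constants $C>0$, $C_1,C_2\in\mathbb{R}$, $\bar\varrho>0$ with $-C\le p(\varrho)\le CP(\varrho)$ for all $\varrho\ge0$, where $P(\varrho):=\varrho\int_{\bar\varrho}^{\varrho}\frac{p(s)}{s^2}\,ds + C_1\varrho + C_2\ge 0$. The Lagrangian system (L) for unknowns $\eta,\sigma:[0,T]\times\mathbb{T}^d\to\mathbb{R}$ is \[ \partial_t\eta+\eta\sigma=0,\qquad \sigma=p(\eta)-\{p(\eta)\}_\sigma, \] understood as $\eta(t,y)=\varrho_0(y)-\int_0^t\eta(s,y)\sigma(s,y)\,ds$ and $\sigma(t,y)=p(\eta(t,y))-\{p(\eta)\}_\sigma(t)$ for a.e. $(t,y)$, where for a function $f(t,y)$ \[ \{f\}_\sigma(t)=\frac{1}{|\mathbb{T}^d|}\int_{\mathbb{T}^d}f(t,y)\exp\Big(\int_0^t\sigma(s,y)\,ds\Big)\,dy. \] *)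

(* Defs.v *)
From HB Require Import structures.
From mathcomp Require Import all_boot all_order all_algebra.
From mathcomp Require Import all_classical all_reals all_analysis.
Unset Strict Implicit. Unset Printing Implicit Defensive.
Import Order.TTheory GRing.Theory Num.Theory.
Import numFieldNormedType.Exports.
Local Open Scope classical_set_scope.
Local Open Scope ring_scope.

(* The torus T^d is represented by its fundamental domain, the unit cube
   [0,1]^d inside d.-tuple R (with the library's product sigma-algebra).
   Its Haar (= normalized Lebesgue) measure is the d-fold product of the
   Lebesgue measure restricted to [0,1]; we define it by iterated
   integration (x-sections), the first coordinate being integrated last. *)
Fixpoint torus_measure (R : realType) (n : nat) : set (n.-tuple R) -> \bar R :=
  match n with
  | 0%N => fun A => (if `[< A [tuple] >] then 1 else 0)%E
  | n'.+1 => fun A =>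
      (\int[@lebesgue_measure R]_(x in `[0%R, 1%R]) 
          torus_measure R n' [set t : n'.-tuple R | A (cons_tuple (x : R) t)])%E
  end.
Arguments torus_measure {R} n _.

Definition cube (R : realType) (n : nat) : set (n.-tuple R) :=
  [set y | forall i : 'I_n, 0 <= tnth y i <= 1].
Arguments cube {R} n _.

Definition spacetime_measure (R : realType) (n : nat) (T : R) :
    set (R * n.-tuple R) -> \bar R :=
  fun A => (\int[@lebesgue_measure R]_(t in `[0%R, T])
              torus_measure n (xsection A t))%E.
Arguments spacetime_measure {R} n T _.

Definition Linf_torus (R : realType) (n : nat) (f : n.-tuple R -> R) : Prop :=
  measurable_fun (cube n) f /\
  exists M : R, {ae torus_measure n, forall y, `|f y| <= M}.
Arguments Linf_torus {R n} f.

Definition Linf_spacetime (R : realType) (n : nat) (T : R)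
    (f : R * n.-tuple R -> R) : Prop :=
  measurable_fun (`[0, T] `*` cube n) f /\
  exists M : R, {ae spacetime_measure n T, forall z, `|f z| <= M}.
Arguments Linf_spacetime {R n} T f.

Definition oint (R : realType) (a b : R) (f : R -> R) : R :=
  if a <= b then (\int[@lebesgue_measure R]_(s in `[a, b]) f s)
  else - (\int[@lebesgue_measure R]_(s in `[b, a]) f s).
Arguments oint {R} a b f.

Definition Hp (R : realType) (p : R -> R) : Prop :=
  {within `[0, +oo[, continuous p} /\
  (exists p' : R -> R, {within `[0, +oo[, continuous p'} /\
      forall x : R, 0 < x -> is_derive x 1 p (p' x)) /\
  (forall M : R, exists x : R, 0 <= x /\ M < p x) /\
  (exists (C C1 C2 rhobar : R), 0 < C /\ 0 < rhobar /\
     let P := fun rho => rho * oint rhobar rho (fun s => p s / s ^+ 2) + C1 * rho + C2 in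
     forall rho : R, 0 < rho -> - C <= p rho /\ p rho <= C * P rho /\ 0 <= P rho).

Arguments Hp {R} p.

(* {f}_sigma(t) = 1/|T^d| int_{T^d} f(t,y) exp(int_0^t sigma(s,y) ds) dy ;
   here |T^d| = torus_measure n setT = 1. *)
Definition sigma_avg (R : realType) (n : nat) (sigma f : R * n.-tuple R -> R)
    (t : R) : R :=
  fine (\int[torus_measure n]_(y in cube n)
          (f (t, y) * expR (\int[@lebesgue_measure R]_(s in `[0, t]) sigma (s, y)))%:E)%E.

Arguments sigma_avg {R n} sigma f t.

(* (eta, sigma) solves the Lagrangian system (L) on [0,T] x T^d with datum rho0,
   in the integrated sense, for a.e. (t,y). *)
Definition solves_L (R : realType) (n : nat) (p : R -> R) (rho0 : n.-tuple R -> R)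
    (T : R) (eta sigma : R * n.-tuple R -> R) : Prop :=
  {ae spacetime_measure n T, forall z : R * n.-tuple R,
     eta z = rho0 z.2 - (\int[@lebesgue_measure R]_(s in `[0, z.1])
                            (eta (s, z.2) * sigma (s, z.2))) /\
     sigma z = p (eta z) - sigma_avg sigma (fun w => p (eta w)) z.1}.
Arguments solves_L {R n} p rho0 T eta sigma.

(* Main.v *)
Require Import Defs.
From HB Require Import structures.
From mathcomp Require Import all_boot all_order all_algebra.
From mathcomp Require Import all_classical all_reals all_analysis.
From mathcomp Require Import measurable_realfun.
From mathcomp Require Import ring lra.
Import Order.TTheory GRing.Theory Num.Theory.
Import numFieldNormedType.Exports.
Local Open Scope classical_set_scope.
Local Open Scope ring_scope.

(* With J = exp(int_0^t sigma) one has eta J = rho0, and everything is governed by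
   the primitive K = int_0^t p(eta): normalizing the total mass of J to 1 gives
   J = e^K / int e^K, so (L) becomes K' = p(rho0 e^(-K) int e^K), which for a
   truncated (bounded, Lipschitz) pressure is globally Lipschitz in the sup norm
   and is solved by Picard iteration, for all times at once.

   Truncation is harmless: P(eta) J has dissipation (p(eta) - {p(eta)})^2 J in
   the mean, so {p(eta)} <= C int P(eta) J stays below a constant K0 depending
   only on rho0, and eta' = - eta (p(eta) - {p(eta)}) cannot cross a level r with
   p(r) > K0. Such an r exists because p is unbounded above; it does not depend on
   T.

   For uniqueness, any solution agrees a.e. with one that is bounded and measurable
   everywhere and has eta >= 0; the sup-norm distance of two such solutions,
   weighted by e^(-ct), is at most half of itself. *)

Set Implicit Arguments.
Unset Strict Implicit.
Unset Printing Implicit Defensive.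

(** * Measure-theoretic preliminaries *)

Section measure_extensionality.
Import HBNNSimple.

(** The mean in (L) is weighted by the unknown [J]. Passing to K loses nothing: the total mass Z of
    J obeys Z' = {p(eta)} (1 - Z) with Z = 1 at time 0. It gains a global Lipschitz constant,
    because the logarithm of an average of exponentials is 1-Lipschitz in the sup norm whatever the
    size of K, and because the truncation caps rho0 e^(-K) int e^K, hence also its logarithmic
    derivative, at r. The order of choices must avoid a circle: r is picked from the energy bound
    K0, so K0 may not involve r. The initial energy is therefore estimated by values of p on an
    interval that ends below r. The integral in P is singular at density 0, while rho0 may vanish on
    a set of positive measure. On that set the energy argument is replaced by the limit of the
    inequality p <= C P at 0. The measure in the statement is a bare set function. It is exchanged
    for a probability that agrees with it on measurable sets, and the analysis runs over an
    arbitrary probability space. *)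

Lemma integral_eq_on_measurable d (T : measurableType d) (R : realType)
    (m1 m2 : set T -> \bar R) (D : set T) (f : T -> \bar R) :
  (forall A, measurable A -> m1 A = m2 A) ->
  (\int[m1]_(x in D) f x = \int[m2]_(x in D) f x)%E.
Proof.
move=> m12; rewrite /integral.
have E (g : {nnsfun T >-> R}) : sintegral m1 g = sintegral m2 g.
  by rewrite /sintegral; apply: eq_fsbigr => x _; rewrite m12.
by congr (ereal_sup _ - ereal_sup _)%E; apply/seteqP; split => _ [h hf <-];
  exists h => //; rewrite E.
Qed.

Lemma ae_eq_on_measurable d (T : measurableType d) (R : realType)
    (m1 m2 : set T -> \bar R) (P : T -> Prop) :
  (forall A, measurable A -> m1 A = m2 A) ->
  {ae m1, forall x, P x} <-> {ae m2, forall x, P x}.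
Proof.
move=> m12; split=> -[A [mA A0 PA]]; exists A; split => //.
  by rewrite -m12. by rewrite m12.
Qed.

End measure_extensionality.

Section torus_probability.
Context {R : realType}.

Let consT n (z : measurableTypeR R * n.-tuple R) : n.+1.-tuple R :=
  cons_tuple z.1 z.2.

Let measurable_consT n : measurable_fun setT (@consT n).
Proof.
rewrite (_ : @consT n = fun z => [the n.+1.-tuple R of z.1 :: z.2]); last first.
  by apply/funext => z; exact/val_inj.
apply: measurable_cons; [exact: measurable_fst|exact: measurable_snd].
Qed.

(** By induction, the iterated integral is the image of uniform measure times the previous
    probability under adjoining a first coordinate. Agreement on measurable sets suffices, since
    integrals and null sets are defined through measurable sets only. *)
Lemma torus_measure_probability n : exists mu : probability (n.-tuple R) R,
  forall A, measurable A -> torus_measure n A = mu A.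
Proof.
elim: n => [|n [mu muE]].
  exists (dirac [tuple]) => A mA /=; rewrite diracE.
  case: asboolP => hA; first by rewrite mem_set.
  by rewrite memNset.
pose nu : probability _ R := (uniform_prob (@ltr01 R) \x mu)%E.
pose X : {mfun (measurableTypeR R * n.-tuple R)%type >-> n.+1.-tuple R} :=
  mfun_Sub (mem_set (@measurable_consT n)).
exists (distribution nu X) => A mA.
rewrite /distribution /pushforward /=.
have mA' : measurable (@consT n @^-1` A).
  by rewrite -[X in measurable X]setTI; exact: measurable_consT.
rewrite /product_measure1 integral_uniform//=; last first.
  exact: measurable_fun_xsection.
rewrite subr0 invr1 mul1e; apply: eq_integral => x _.
rewrite -muE; last exact: measurable_xsection.
by congr torus_measure; apply/seteqP; split=> t; rewrite /xsection/= inE.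
Qed.

End torus_probability.

(** * Null sets, sections of product null sets, parametric integrals *)

Section null_sets.
Import HBNNSimple.
Context d (T : measurableType d) (R : realType) (mu : {measure set T -> \bar R}).

(** Working with simple minorants avoids any measurability of [f] and [g]: a minorant of [f] set to
    0 on [N] is a minorant of [g], and its level sets at nonzero values change by null sets only. *)
Let le_ereal_sup_off_null (N : set T) (f g : T -> \bar R) :
  measurable N -> mu N = 0%E -> (forall x, 0 <= g x)%E ->
  (forall x, ~ N x -> f x = g x) ->
  (ereal_sup [set sintegral mu h | h in [set h : {nnsfun T >-> R} |
     forall x, ((h x)%:E <= f x)%E]] <=
   ereal_sup [set sintegral mu h | h in [set h : {nnsfun T >-> R} |
     forall x, ((h x)%:E <= g x)%E]])%E.
Proof.
move=> mN N0 g0 fg; apply: ge_ereal_sup => _ [h /= hf <-].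
have mNC : measurable (~` N) by exact: measurableC.
have hE x : proj_nnsfun h mNC x = if x \in ~` N then h x else 0.
  by rewrite -mrestrict patchE.
apply: ereal_sup_ubound; exists (proj_nnsfun h mNC).
  move=> x; rewrite hE; case: ifPn => [|_]; last exact: g0.
  by rewrite inE => Nx; rewrite -fg.
rewrite (eq_sintegral (fun x => if x \in ~` N then h x else 0)); last by move=> x; rewrite hE.
rewrite /sintegral; apply: eq_fsbigr => x _.
have [->|x0] := eqVneq x 0; first by rewrite !mul0e.
congr (_ * _)%E.
have mh : measurable (h @^-1` [set x]) by [].
have hN0 : mu (h @^-1` [set x] `&` N) = 0%E.
  apply/eqP; rewrite -measure_le0 -N0 le_measure ?inE//; exact: measurableI.
have := measureDI mu mh mN; rewrite /= hN0 adde0 => ->.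
congr (mu _); apply/seteqP; split => t; rewrite /preimage/=.
  case: ifPn => [|_]; first by rewrite inE.
  by move=> /esym/eqP; rewrite (negbTE x0).
by move=> [<- Nt]; rewrite mem_set.
Qed.

(* [p] is arbitrary on the negative reals, so [p \o eta] need not be measurable on
   the null set where [eta < 0]. *)
Lemma eq_integral_off_null (D N : set T) (f g : T -> \bar R) :
  measurable N -> mu N = 0%E -> (forall x, D x -> ~ N x -> f x = g x) ->
  (\int[mu]_(x in D) f x = \int[mu]_(x in D) g x)%E.
Proof.
move=> mN N0 fg.
have E x : ~ N x -> (f \_ D) x = (g \_ D) x.
  by move=> Nx; rewrite !patchE; case: ifPn => //; rewrite inE => Dx; exact: fg.
rewrite /integral; congr (_ - _)%E; apply/eqP; rewrite eq_le; apply/andP; split;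
  apply: (le_ereal_sup_off_null mN N0) => //= x Nx;
  by rewrite ?funeposE ?funenegE E.
Qed.

End null_sets.

Section sections.
Context d1 d2 (T1 : measurableType d1) (T2 : measurableType d2) (R : realType).
Variables (m1 : {sigma_finite_measure set T1 -> \bar R})
  (m2 : {sigma_finite_measure set T2 -> \bar R}).

(** Integrability is not assumed: Tonelli handles the positive and negative parts separately. *)
Lemma measurable_fun_Rintegral (f : T1 * T2 -> R) : measurable_fun setT f ->
  measurable_fun setT (fun x => \int[m2]_y f (x, y)).
Proof.
move=> mf; rewrite /Rintegral; apply: (measurableT_comp (@fine_measurable R setT measurableT)).
rewrite (_ : (fun x => _) = (fubini_F m2 (EFin \o f)^\+ \- fubini_F m2 (EFin \o f)^\-)%E).
  have mfE : measurable_fun setT (EFin \o f) by exact/measurable_EFinP.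
  apply: emeasurable_funB; apply: measurable_fun_fubini_tonelli_F => //.
    exact: measurable_funepos.
  exact: measurable_funeneg.
apply/funext => x; rewrite /= [LHS]integralE; congr (_ - _)%E.
  by apply: eq_integral => y _; rewrite !funeposE.
by apply: eq_integral => y _; rewrite !funenegE.
Qed.

Lemma ae_prod_sectionx (P : T1 * T2 -> Prop) :
  {ae (m1 \x m2)%E, forall z, P z} ->
  {ae m1, forall x, {ae m2, forall y, P (x, y)}}.
Proof.
move=> [N [mN N0 PN]].
have : ae_eq m1 setT (m2 \o xsection N) (cst 0%E).
  apply/ae_eq_integral_abs => //; first exact: measurable_fun_xsection.
  by rewrite -[RHS]N0; apply: eq_integral => x _; rewrite gee0_abs.
apply: filterS => x /(_ Logic.I) /= Nx0; exists (xsection N x); split => //.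
  exact: measurable_xsection.
by move=> y /= Py; rewrite /xsection /= inE; exact: PN.
Qed.

Lemma ae_prod_sectiony (P : T1 * T2 -> Prop) :
  {ae (m1 \x m2)%E, forall z, P z} ->
  {ae m2, forall y, {ae m1, forall x, P (x, y)}}.
Proof.
move=> [N [mN N0 PN]].
(* Sections in the other variable are controlled by the product taken in the opposite order; the two
   products agree by uniqueness. *)
have N0' : (m1 \x^ m2)%E N = 0%E.
  rewrite -N0; apply/esym/product_measure_unique => // A B mA mB.
  exact: product_measure2E.
have : ae_eq m2 setT (m1 \o ysection N) (cst 0%E).
  apply/ae_eq_integral_abs => //; first exact: measurable_fun_ysection.
  by rewrite -[RHS]N0'; apply: eq_integral => x _; rewrite gee0_abs.
apply: filterS => y /(_ Logic.I) /= Ny0; exists (ysection N y); split => //.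
  exact: measurable_ysection.
by move=> x /= Px; rewrite /ysection /= inE; exact: PN.
Qed.

Lemma ae_prod1 (P : T1 -> Prop) :
  {ae m1, forall x, P x} -> {ae (m1 \x m2)%E, forall z, P z.1}.
Proof.
move=> [N [mN N0 PN]]; exists (N `*` setT); split.
- exact: measurableX.
- by rewrite -[RHS](mul0e (m2 setT)) -N0; exact: product_measure1E.
- by move=> [x y] /= Px; split => //; exact: PN.
Qed.

Lemma ae_prod2 (P : T2 -> Prop) :
  {ae m2, forall y, P y} -> {ae (m1 \x m2)%E, forall z, P z.2}.
Proof.
move=> [N [mN N0 PN]]; exists (setT `*` N); split.
- exact: measurableX.
- by rewrite -[RHS](mule0 (m1 setT)) -N0; exact: product_measure1E.
- by move=> [x y] /= Px; split => //; exact: PN.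
Qed.

End sections.

Section bounded_integrals.
Context d (T : measurableType d) (R : realType) (mu : {measure set T -> \bar R}).

Lemma integrable_bounded (D : set T) (f : T -> R) (M : R) :
  measurable D -> (mu D < +oo)%E -> measurable_fun D f ->
  (forall x, D x -> `|f x| <= M) -> mu.-integrable D (EFin \o f).
Proof.
move=> mD muD mf fM; apply: measurable_bounded_integrable => //.
exists M; split; first exact: num_real.
by move=> x Mx y Dy; exact: le_trans (fM _ Dy) (ltW Mx).
Qed.

Lemma integrable_probability (P : probability T R) (f : T -> R) (M : R) :
  measurable_fun setT f -> (forall x, `|f x| <= M) ->
  P.-integrable setT (EFin \o f).
Proof.
move=> mf fM; apply: (@measurable_bounded_integrable _ _ _ P f setT) => //.
  by apply: (le_lt_trans (probability_le1 P measurableT)); rewrite ltry.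
exists M; split; first exact: num_real.
by move=> x Mx y _; exact: le_trans (fM _) (ltW Mx).
Qed.

End bounded_integrals.

Section time_integrals.
Context d (Y : measurableType d) (R : realType).
Notation lam := (@lebesgue_measure R).

Lemma lebesgue_itv_lty (a b : R) : (lam `[a, b] < +oo)%E.
Proof.
by rewrite lebesgue_measure_itv/=; case: ifP => _; rewrite -?EFinB ltry.
Qed.

Lemma integrable_itv (a b : R) (f : R -> R) (M : R) :
  measurable_fun setT f -> (forall x, a <= x <= b -> `|f x| <= M) ->
  lam.-integrable `[a, b] (EFin \o f).
Proof.
move=> mf fM; apply: (@integrable_bounded _ _ _ _ _ _ M) => //.
- exact: lebesgue_itv_lty.
- exact: measurable_funTS.
Qed.

(** The moving upper limit of integration is stored in an indicator, which leaves an integral over a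
    fixed domain with a parameter. *)
Let measurable_time_indic (g : R * Y -> R) : measurable_fun setT g ->
  measurable_fun setT (fun w : (R * Y) * R =>
    g (w.2, w.1.2) * ((0 <= w.2) && (w.2 <= w.1.1))%:R).
Proof.
move=> mg; apply: measurable_funM.
  apply: (@measurableT_comp _ _ _ _ _ _ g) => //; apply: measurable_fun_pair.
    exact: measurable_snd.
  by apply: measurableT_comp; [exact: measurable_snd|exact: measurable_fst].
have -> : (fun w : (R * Y) * R => ((0 <= w.2) && (w.2 <= w.1.1))%:R : R) =
    (fun w => if (0 <= w.2) && (w.2 <= w.1.1) then 1 else 0).
  by apply/funext => w; case: ifP.
apply: measurable_fun_ifT => //; apply: measurable_and.
  by apply: measurable_fun_ler => //; exact: measurable_snd.
apply: measurable_fun_ler; first exact: measurable_snd.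
by apply: measurableT_comp; [exact: measurable_fst|exact: measurable_fst].
Qed.

Lemma measurable_fun_time_integral (g : R * Y -> R) : measurable_fun setT g ->
  measurable_fun setT (fun z : R * Y => \int[lam]_(s in `[0, z.1]) g (s, z.2)).
Proof.
move=> mg.
have := measurable_fun_Rintegral lam
  (measurable_time_indic mg).
congr (measurable_fun _ _); apply/funext => -[t y] /=.
rewrite [RHS]Rintegral_mkcond; apply: eq_Rintegral => s _ /=.
by rewrite patchE mem_setE in_itv/=; case: ifP; rewrite ?mulr1 ?mulr0.
Qed.

(** The bound is asked for on [[0, t]] only, because the integrands in use contain exponentials that
    grow with time. *)
Lemma Rintegral_time_swap (mu : probability Y R) (g : R * Y -> R) (B t : R) :
  measurable_fun setT g ->
  (forall (s : R) y, 0 <= s <= t -> `|g (s, y)| <= B) ->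
  \int[mu]_y (\int[lam]_(s in `[0, t]) g (s, y)) =
  \int[lam]_(s in `[0, t]) (\int[mu]_y g (s, y)).
Proof.
move=> mg gB.
pose I : set (measurableTypeR R) := [set` `[0, t]].
pose D : set (measurableTypeR R * Y) := I `*` setT.
have mI : measurable I by exact: measurable_itv.
have mD : measurable D by exact: measurableX.
have igD : (lam \x mu)%E.-integrable D (EFin \o g).
  apply: (@integrable_bounded _ _ _ (lam \x mu)%E D g B) => //.
    apply: (@le_lt_trans _ _ (lam I * mu setT)%E); last first.
      by rewrite probability_setT mule1; exact: lebesgue_itv_lty.
    by rewrite le_eqVlt; apply/orP; left; apply/eqP; exact: product_measure1E.
    exact: measurable_funTS.
  by move=> [s y] [/= + _]; rewrite /I /= in_itv/= => /gB; exact.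
have ig := (integrable_mkcond (mu := (lam \x mu)%E) (EFin \o g) mD).1 igD.
have gy s : 0 <= s <= t -> mu.-integrable setT (EFin \o (fun y => g (s, y))).
  move=> st; apply: (@integrable_probability _ _ _ _ _ B); first exact: measurableT_comp.
  by move=> y; exact: gB.
have gs y : lam.-integrable `[0, t] (EFin \o (fun s => g (s, y))).
  apply: (@integrable_itv _ _ _ B); first exact: measurableT_comp.
  by move=> s; exact: gB.
rewrite /Rintegral; congr fine.
transitivity (\int[mu]_y \int[lam]_(s in I) (g (s, y))%:E)%E.
  by apply: eq_integral => y _; rewrite fineK//; apply: integrable_fin_num => //; exact: gs.
transitivity (\int[lam]_(s in I) \int[mu]_y (g (s, y))%:E)%E; last first.
  apply: eq_integral => s; rewrite inE /I/= in_itv/= => st.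
  by rewrite fineK//; apply: integrable_fin_num => //; exact: gy.
transitivity (\int[lam]_s \int[mu]_y ((EFin \o g) \_ D) (s, y))%E.
  rewrite (Fubini ig); apply: eq_integral => y _.
  rewrite [LHS]integral_mkcond; apply: eq_integral => s _; rewrite !patchE.
  case: ifPn => sT; first by rewrite mem_set//; split => //; rewrite inE in sT.
  by rewrite memNset// => -[/=]; move/mem_set; rewrite (negbTE sT).
rewrite [RHS]integral_mkcond; apply: eq_integral => s _; rewrite patchE.
case: ifPn => sT.
  by apply: eq_integral => y _; rewrite patchE mem_set//; split => //; rewrite inE in sT.
rewrite integral0_eq// => y _; rewrite patchE memNset// => -[/=].
by move/mem_set; rewrite (negbTE sT).
Qed.

End time_integrals.

(** * Calculus *)

Section calculus.
Context (R : realType).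
Notation lam := (@lebesgue_measure R).
Implicit Types (f g F : R -> R).

Lemma lipschitz_continuousR f k : (forall s t, `|f t - f s| <= k * `|t - s|) ->
  continuous f.
Proof.
move=> fk x; have k0 : 0 <= k.
  have := fk 0 1; rewrite subr0 normr1 mulr1; exact: le_trans.
have k1 : 0 < k + 1 by rewrite ltr_wpDl.
apply/cvgrPdist_le => e e0; near=> y.
rewrite (le_trans (fk _ _))// (@le_trans _ _ ((k + 1) * `|x - y|))//.
  by rewrite ler_wpM2r// lerDl.
rewrite mulrC -ler_pdivlMr//; near: y.
by apply: cvgr_dist_le; [exact: cvg_id|rewrite divr_gt0].
Unshelve. all: by end_near. Qed.

Lemma continuous_integrable_itv f a b : continuous f ->
  lam.-integrable `[a, b] (EFin \o f).
Proof.
move=> cf; apply: continuous_compact_integrable; first exact: segment_compact.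
exact: continuous_subspaceT.
Qed.

Lemma is_derive_time_integral g (t : R) : continuous g -> 0 < t ->
  is_derive t 1 (fun u => \int[lam]_(s in `[0, u]) g s) (g t).
Proof.
move=> cg t0.
have [dF F'] := @continuous_FTC1_closed R g 0 t (t + 1) (ltr_pwDr ltr01 (lexx t))
  (continuous_integrable_itv 0 (t + 1) cg) t0 (cg t).
by apply: DeriveDef; [exact: dF|rewrite -derive1E; exact: F'].
Qed.

Lemma time_integral_FTC2 F f (t : R) : 0 <= t -> continuous F -> continuous f ->
  (forall s : R, 0 < s -> is_derive s 1 F (f s)) ->
  \int[lam]_(s in `[0, t]) f s = F t - F 0.
Proof.
rewrite le_eqVlt => /predU1P[<- _ _ _|t0 cF cf dF].
  by rewrite set_itv1 Rintegral_set1 subrr.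
rewrite /Rintegral (@continuous_FTC2 R f F 0 t t0) //.
- exact: continuous_subspaceT.
- split; first by move=> s; rewrite in_itv/= => /andP[s0 _]; have [] := dF s s0.
    exact: cvg_at_right_filter (cF 0).
  exact: cvg_at_left_filter (cF t).
- move=> s; rewrite in_itv/= => /andP[s0 _]; rewrite derive1E.
  by have [_ ->] := dF s s0.
Qed.

Lemma le_normr_time_integral f (B t : R) : measurable_fun setT f ->
  (forall s, `|f s| <= B) -> 0 <= t -> `|\int[lam]_(s in `[0, t]) f s| <= B * t.
Proof.
move=> mf fB t0; have itf := integrable_itv mf (fun s (_ : 0 <= s <= t) => fB s).
apply: (le_trans (le_normr_Rintegral _ itf)) => //.
have -> : B * t = \int[lam]_(s in `[0, t]) B.
  rewrite Rintegral_cst//= lebesgue_measure_itv/= lte_fin; case: ifPn => [_|].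
    by rewrite /= subr0.
  by rewrite -leNgt => t0'; rewrite (@le_anti _ _ t 0) ?t0 ?t0'// mulr0.
apply: le_Rintegral => //.
  apply: (@integrable_itv _ _ _ _ B); first exact: measurableT_comp.
  by move=> s _; rewrite normr_id.
by apply: (@integrable_itv _ _ _ _ `|B|) => //.
Qed.

Lemma time_integral_lipschitz f (B : R) : measurable_fun setT f ->
  (forall s, `|f s| <= B) -> forall s t : R,
  `|\int[lam]_(u in `[0, t]) f u - \int[lam]_(u in `[0, s]) f u| <= B * `|t - s|.
Proof.
move=> mf fB; have B0 : 0 <= B by exact: le_trans (fB 0).
(* Below 0 the interval is empty and the primitive is 0, so the Lipschitz bound extends to the whole
   line and continuity never has to be relativized. *)
have neg (u : R) : u < 0 -> \int[lam]_(v in `[0, u]) f v = 0.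
  by move=> u0; rewrite set_itv_ge ?Rintegral_set0// bnd_simp -ltNge.
have main (s t : R) : s <= t ->
    `|\int[lam]_(u in `[0, t]) f u - \int[lam]_(u in `[0, s]) f u| <= B * `|t - s|.
  move=> st; have [t0|t0] := ltP t 0.
    by rewrite !neg ?subrr ?normr0 ?mulr_ge0// (le_lt_trans st).
  have [s0|s0] := ltP s 0.
    rewrite (neg s)// subr0 (le_trans (le_normr_time_integral mf fB t0))//.
    by rewrite ler_wpM2l//; have := ler_norm (t - s); lra.
  have itf := integrable_itv mf (fun u (_ : 0 <= u <= t) => fB u).
  rewrite Rintegral_itvB ?bnd_simp//.
  have itf' : lam.-integrable `]s, t] (EFin \o f).
    by apply: integrableS itf => //; apply: subset_itvr; rewrite bnd_simp.
  apply: (le_trans (le_normr_Rintegral _ itf')) => //.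
  have -> : B * `|t - s| = \int[lam]_(u in `]s, t]) B.
    rewrite Rintegral_cst//= lebesgue_measure_itv/= lte_fin ger0_norm ?subr_ge0//.
    case: ifPn => [_|]; first by rewrite /= .
    by rewrite -leNgt => ts; rewrite (@le_anti _ _ t s) ?st ?ts// subrr mulr0.
  have sub : [set` `]s, t]] `<=` [set` `[s, t]] by apply: subset_itvr; rewrite bnd_simp.
  have i1 : lam.-integrable `[s, t] (EFin \o (fun u => `|f u|)).
    apply: (@integrable_itv _ _ _ _ B); first exact: measurableT_comp.
    by move=> u _; rewrite normr_id.
  have i2 : lam.-integrable `[s, t] (EFin \o (fun u => B)).
    by apply: (@integrable_itv _ _ _ _ `|B|) => //.
  by apply: le_Rintegral => //; [exact: integrableS i1|exact: integrableS i2].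
move=> s t; have [st|/ltW ts] := leP s t; first exact: main.
by rewrite distrC [X in B * X]distrC main.
Qed.

Lemma time_integral_expR (c t : R) : 0 < c -> 0 <= t ->
  \int[lam]_(s in `[0, t]) expR (c * s) = (expR (c * t) - 1) / c.
Proof.
move=> c0 t0.
have cc : continuous (fun s : R => c * s) by move=> s; exact: mulrl_continuous.
transitivity (expR (c * t) / c - expR (c * 0) / c); last first.
  by rewrite mulr0 expR0; field; rewrite gt_eqF.
apply: (@time_integral_FTC2 (fun s : R => expR (c * s) / c)) => //.
- move=> s; apply: cvgMl => /=; apply: continuous_comp; [exact: cc|exact: continuous_expR].
- move=> s; apply: continuous_comp; [exact: cc|exact: continuous_expR].
- move=> s _; apply: is_derive_eq; rewrite /GRing.scale/=.
  by field; rewrite gt_eqF.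
Qed.

(* [A e^{ct} / c] rather than [A (e^{ct} - 1) / c]: the bound is again a
   multiple of the weight, so it can be iterated. *)
Lemma le_normr_time_integral_expR f (A c t : R) : measurable_fun setT f -> 0 <= A -> 0 < c ->
  {ae lam, forall s, 0 <= s <= t -> `|f s| <= A * expR (c * s)} ->
  `|\int[lam]_(s in `[0, t]) f s| <= A / c * expR (c * t).
Proof.
move=> mf A0 c0 [N [mN N0 fN]].
have [t0|t0] := ltP t 0.
  rewrite set_itv_ge ?bnd_simp -?ltNge// Rintegral_set0 normr0.
  by rewrite mulr_ge0 ?expR_ge0// divr_ge0// ltW.
pose f1 := f \_ (~` N).
have mNC : measurable (~` N) by exact: measurableC.
have mf1 : measurable_fun setT f1.
  by apply/(measurable_restrictT _ mNC); exact: measurable_funTS.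
have f1E s : 0 <= s <= t -> `|f1 s| <= A * expR (c * s).
  move=> st; rewrite /f1 patchE; case: ifPn => [|_].
    by rewrite inE => Ns; apply: contrapT => h; apply: Ns; apply: fN => /= /(_ st).
  by rewrite normr0 mulr_ge0// expR_ge0.
have -> : \int[lam]_(s in `[0, t]) f s = \int[lam]_(s in `[0, t]) f1 s.
  congr fine; apply: (eq_integral_off_null mN N0) => s _ Ns.
  by rewrite /f1 patchE mem_set.
have f1B s : 0 <= s <= t -> `|f1 s| <= A * expR (c * t).
  move=> /[dup] st /f1E /le_trans; apply; rewrite ler_wpM2l// ler_expR.
  by rewrite ler_pM2l//; case/andP: st.
have itf := integrable_itv mf1 f1B.
apply: (le_trans (le_normr_Rintegral _ itf)) => //.
have cc : continuous (fun s : R => A * expR (c * s)).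
  move=> s; apply: cvgMr; apply: continuous_comp; last exact: continuous_expR.
  exact: mulrl_continuous.
apply: (@le_trans _ _ (\int[lam]_(s in `[0, t]) (A * expR (c * s)))).
  have i1 : lam.-integrable `[0, t] (EFin \o (fun s => `|f1 s|)).
    apply: (@integrable_itv _ _ _ _ (A * expR (c * t))); first exact: measurableT_comp.
    by move=> s /f1B; rewrite normr_id.
  by apply: (le_Rintegral _ i1 (continuous_integrable_itv 0 t cc)).
rewrite RintegralZl//; last first.
  apply: continuous_integrable_itv => s.
  by apply: continuous_comp; [exact: mulrl_continuous|exact: continuous_expR].
rewrite time_integral_expR// -mulrA ler_wpM2l// mulrC ler_pM2l ?invr_gt0//.
by rewrite gerBl.
Qed.

(** With [e n] the sum of all step bounds from [n] on, [u - e] increases and [u + e] decreases to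
    the same limit; this gives convergence and the error bound together. *)
Lemma geometric_cvg (u : R^nat) (E : R) :
  (forall n, `|u n.+1 - u n| <= E / 2 ^+ n) ->
  exists l, (u n @[n --> \oo] --> l) /\ forall n, `|l - u n| <= 2 * E / 2 ^+ n.
Proof.
move=> uE; pose e n : R := 2 * E / 2 ^+ n.
have eS n : e n = e n.+1 + E / 2 ^+ n.
  by rewrite /e exprS; field; rewrite expf_neq0.
have E0 : 0 <= E by have := uE 0%N; rewrite expr0 divr1; exact: le_trans.
have e0 n : 0 <= e n by rewrite /e divr_ge0 ?mulr_ge0// exprn_ge0.
have ndu : nondecreasing_seq (fun n => u n - e n).
  apply/nondecreasing_seqP => n; have := uE n; rewrite ler_norml (eS n) => /andP[+ _].
  by move=> h; lra.
have niu : nonincreasing_seq (fun n => u n + e n).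
  apply/nonincreasing_seqP => n; have := uE n; rewrite ler_norml (eS n) => /andP[_ +].
  by move=> h; lra.
have cvge : e n @[n --> \oo] --> (0 : R).
  have -> : e = geometric (2 * E) (2^-1).
    by apply/funext => n; rewrite /geometric /= exprVn.
  apply: cvg_geometric; rewrite ger0_norm ?invr_ge0//.
  by rewrite invf_lt1// ltr1n.
have ubu n : u n - e n <= u 0%N + e 0%N.
  by apply: (@le_trans _ _ (u n + e n)); [have := e0 n; lra|exact: niu].
have cvu : cvgn (fun n => u n - e n).
  apply: nondecreasing_is_cvgn => //; exists (u 0%N + e 0%N) => _ [n _ <-]; exact: ubu.
set l := limn (fun n => u n - e n).
have cu : u @ \oo --> l.
  have h : (fun n => u n - e n) + e @ \oo --> l + 0 by apply: cvgD.
  have E1 : (fun n => u n - e n) + e = u by apply/funext => n; rewrite fctE subrK.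
  by rewrite E1 addr0 in h.
have cvu' : (fun n => u n + e n) @ \oo --> l.
  have h : u + e @ \oo --> l + 0 by apply: cvgD.
  by rewrite addr0 in h.
exists l; split => // n; rewrite ler_norml -/(e n); apply/andP; split.
  by have := nondecreasing_cvgn_le ndu cvu n; rewrite -/l; lra.
have cvu2 : cvgn (fun n => u n + e n) by apply/cvg_ex; exists l.
have := nonincreasing_cvgn_ge niu cvu2 n.
by rewrite (cvg_lim _ cvu')//; lra.
Unshelve. all: by end_near. Qed.

Lemma le0_of_geometric_bound (x E : R) : (forall n, x <= E / 2 ^+ n) -> x <= 0.
Proof.
move=> xE.
have cvge : E / 2 ^+ n @[n --> \oo] --> (0 : R).
  have -> : (fun n => E / 2 ^+ n) = geometric E (2^-1).
    by apply/funext => n; rewrite /geometric /= exprVn.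
  apply: cvg_geometric; rewrite ger0_norm ?invr_ge0//.
  by rewrite invf_lt1// ltr1n.
rewrite -(cvg_lim _ cvge)//; apply: limr_ge; first by apply/cvg_ex; exists 0.
exact: nearW.
Qed.

(** A mean value bound with a sum in place of a maximum: the sum can be averaged exactly when both
    exponentials have mean 1. *)
Lemma le_expR_dist (x y : R) : `|expR x - expR y| <= `|x - y| * (expR x + expR y).
Proof.
wlog xy : x y / x <= y.
  move=> H; have [/H//|/ltW /H] := leP x y.
  by rewrite distrC [in X in _ <= X -> _]distrC [expR y + _]addrC.
rewrite ler0_norm ?subr_le0 ?ler_expR// ler0_norm ?subr_le0// !opprB.
have h : 1 + (x - y) <= expR (x - y) by exact: expR_ge1Dx.
have := expR_gt0 x; have := expR_gt0 y.
have : expR x = expR (x - y) * expR y by rewrite -expRD subrK.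
move=> -> Ey Ex.
apply: (@le_trans _ _ ((y - x) * expR y)).
  rewrite -[X in X - _]mul1r -mulrBl ler_pM2r//; lra.
by rewrite mulrDr lerDr mulr_ge0// ?subr_ge0// ltW.
Qed.

End calculus.

(** * Averages over a probability space *)

Section probability_averages.
Context d (Y : measurableType d) (R : realType) (mu : probability Y R).

Lemma le_normr_average (f : Y -> R) (A : R) : measurable_fun setT f ->
  {ae mu, forall y, `|f y| <= A} -> `|\int[mu]_y f y| <= A.
Proof.
move=> mf fA.
(* A negative [A] would make the exceptional set the whole space, which has mass 1. *)
have A0 : 0 <= A.
  case: fA => N [mN N0 fN]; rewrite leNgt; apply/negP => A0.
  suff : mu setT = 0%E by rewrite probability_setT => /eqP; rewrite eqe oner_eq0.
  apply/eqP; rewrite -measure_le0 -N0 le_measure ?inE//.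
  by move=> y _; apply: fN => /= h; move: (le_trans h (ltW A0)) (normr_ge0 (f y));
    rewrite le_eqVlt => /orP[/eqP e|h2] h3; move: (le_lt_trans h A0); lra.
case: fA => N [mN N0 fN].
pose f1 := f \_ (~` N).
have mNC : measurable (~` N) by exact: measurableC.
have mf1 : measurable_fun setT f1.
  by apply/(measurable_restrictT _ mNC); exact: measurable_funTS.
have f1A y : `|f1 y| <= A.
  rewrite /f1 patchE; case: ifPn => [|_]; last by rewrite normr0.
  by rewrite inE => Ny; apply: contrapT => h; exact/Ny/fN.
have -> : \int[mu]_y f y = \int[mu]_y f1 y.
  congr fine; apply: (eq_integral_off_null mN N0) => y _ Ny.
  by rewrite /f1 patchE mem_set.
have itf := integrable_probability mu mf1 f1A.
apply: (le_trans (le_normr_Rintegral _ itf)) => //.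
have -> : A = \int[mu]_y A.
  by rewrite Rintegral_cst// [X in fine X]probability_setT mulr1.
apply: le_Rintegral => //.
  apply: (@integrable_probability _ _ _ _ _ A); first exact: measurableT_comp.
  by move=> y; rewrite normr_id.
by apply: (@integrable_probability _ _ _ _ _ `|A|).
Qed.

End probability_averages.

(** * The normalized flow *)

Section averages.
Context d (Y : measurableType d) (R : realType) (mu : probability Y R).

Lemma le_average (f g : Y -> R) (M N : R) : measurable_fun setT f -> measurable_fun setT g ->
  (forall y, `|f y| <= M) -> (forall y, `|g y| <= N) -> (forall y, f y <= g y) ->
  \int[mu]_y f y <= \int[mu]_y g y.
Proof.
move=> mf mg fM gN fg; apply: le_Rintegral => //.
  exact: integrable_probability fM.
exact: integrable_probability gN.
Qed.

Lemma average_cst (c : R) : \int[mu]_y c = c.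
Proof. by rewrite Rintegral_cst// [X in fine X]probability_setT mulr1. Qed.

Lemma expR_bounded (x M : R) : `|x| <= M -> `|expR x| <= expR M.
Proof.
by move=> xM; rewrite ger0_norm ?expR_ge0// ler_expR (le_trans (ler_norm _)).
Qed.

Lemma average_expR_gt0 (k : Y -> R) (M : R) : measurable_fun setT k ->
  (forall y, `|k y| <= M) -> 0 < \int[mu]_y expR (k y).
Proof.
move=> mk kM; apply: (lt_le_trans (expR_gt0 (- M))).
rewrite -[leLHS]average_cst; apply: (@le_average _ _ `|expR (- M)| (expR M)) => //.
- exact: measurableT_comp.
- by move=> y; exact: expR_bounded.
- by move=> y; rewrite ler_expR; have := kM y; rewrite ler_norml => /andP[].
Qed.

(** The map k -> ln int e^k is monotone and commutes with adding constants, hence is 1-Lipschitz in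
    the sup norm. The bound [M] only ensures integrability and does not enter the constant. *)
Lemma ln_average_lipschitz (k k' : Y -> R) (M delta : R) :
  measurable_fun setT k -> measurable_fun setT k' ->
  (forall y, `|k y| <= M) -> (forall y, `|k' y| <= M) ->
  (forall y, `|k y - k' y| <= delta) ->
  `|ln (\int[mu]_y expR (k y)) - ln (\int[mu]_y expR (k' y))| <= delta.
Proof.
have main (h h' : Y -> R) : measurable_fun setT h -> measurable_fun setT h' ->
    (forall y, `|h y| <= M) -> (forall y, `|h' y| <= M) ->
    (forall y, h y <= h' y + delta) ->
    ln (\int[mu]_y expR (h y)) <= ln (\int[mu]_y expR (h' y)) + delta.
  move=> mh mh' hM h'M hh'.
  have Zh := average_expR_gt0 mh hM; have Zh' := average_expR_gt0 mh' h'M.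
  rewrite -[leRHS]expRK expRD lnK ?posrE// ler_ln ?posrE ?mulr_gt0 ?expR_gt0//.
  have meh' : measurable_fun setT (fun y => expR (h' y)) by exact: measurableT_comp.
  have eh'M y : `|expR (h' y)| <= expR M by exact: expR_bounded.
  rewrite -RintegralZr//; last exact: integrable_probability eh'M.
  apply: (@le_average _ _ (expR M) (expR (M + delta))) => //.
  - exact: measurableT_comp.
  - by apply: measurable_funM.
  - by move=> y; exact: expR_bounded.
  - move=> y; rewrite ger0_norm ?mulr_ge0 ?expR_ge0// -expRD ler_expR lerD2r.
    exact: le_trans (ler_norm _) (h'M y).
  - by move=> y; rewrite -expRD ler_expR.
move=> mk mk' kM k'M kk'; rewrite ler_norml lerBrDr lerBlDl; apply/andP; split.
  rewrite addrC lerBlDr; apply: main => // y.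
  by have := kk' y; rewrite ler_norml => /andP[? ?]; lra.
apply: main => // y.
by have := kk' y; rewrite ler_norml => /andP[? ?]; lra.
Qed.

Lemma le_normr_weighted_average (f w : Y -> R) (B N : R) :
  measurable_fun setT f -> measurable_fun setT w ->
  (forall y, `|f y| <= B) -> (forall y, 0 <= w y <= N) -> \int[mu]_y w y = 1 ->
  `|\int[mu]_y (f y * w y)| <= B.
Proof.
move=> mf mw fB wN w1.
have mfw : measurable_fun setT (fun y => f y * w y) by exact: measurable_funM.
have wN' y : `|w y| <= N by have /andP[w0 ?] := wN y; rewrite ger0_norm.
have fwBN y : `|f y * w y| <= B * N by rewrite normrM ler_pM.
apply: (le_trans (le_normr_Rintegral _ (integrable_probability mu mfw fwBN))) => //.
rewrite -[leRHS]mulr1 -w1 -RintegralZl//; last exact: integrable_probability wN'.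
apply: (@le_average _ _ (B * N) (`|B| * N)) => //.
- exact: measurableT_comp.
- exact: measurable_funM.
- by move=> y; rewrite normr_id.
- by move=> y; rewrite normrM ler_wpM2l.
- by move=> y; rewrite normrM ler_pM// ger0_norm//; have /andP[] := wN y.
Qed.

End averages.

Section flow.
Context d (Y : measurableType d) (R : realType) (mu : probability Y R).
Notation lam := (@lebesgue_measure R).
Variables (F : Y * R -> R) (B Lam : R).
Hypotheses (mF : measurable_fun setT F) (B0 : 0 <= B) (FB : forall z, `|F z| <= B).
Hypotheses (Lam0 : 0 < Lam)
  (FL : forall y l l', `|F (y, l) - F (y, l')| <= Lam * `|l - l'|).

Definition log_mass (K : R * Y -> R) (t : R) : R := ln (\int[mu]_y expR (K (t, y))).

(** [K - log_mass K] is the logarithm of the normalized J. In the application [F (y, l)] is the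
    truncated pressure at density rho0(y) e^(-l). *)
Definition flow_rate (K : R * Y -> R) (w : R * Y) : R :=
  F (w.2, K w - log_mass K w.1).

Definition picard (K : R * Y -> R) (z : R * Y) : R :=
  \int[lam]_(s in `[0, z.1]) flow_rate K (s, z.2).

(** The linear growth is what [picard] produces from any measurable input; it makes the exponentials
    integrable at each time. *)
Definition admissible (K : R * Y -> R) :=
  measurable_fun setT K /\ forall z, `|K z| <= B * `|z.1|.

Let measurable_section (K : R * Y -> R) t : measurable_fun setT K ->
  measurable_fun setT (fun y => K (t, y)).
Proof. by move=> mK; exact: measurableT_comp. Qed.

Lemma measurable_flow_rate K : measurable_fun setT K -> measurable_fun setT (flow_rate K).
Proof.
move=> mK; apply: (measurableT_comp mF); apply: measurable_fun_pair.
  exact: measurable_snd.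
apply: measurable_funB => //; apply: (@measurableT_comp _ _ _ _ _ _ (log_mass K)) => //.
apply: (@measurableT_comp _ _ _ _ _ _ (@ln R)) => //.
have := @measurable_fun_Rintegral _ _ _ _ R mu (fun z => expR (K z)).
by apply; exact: measurableT_comp.
Qed.

Lemma measurable_flow_rate_y K y : measurable_fun setT K ->
  measurable_fun setT (fun s => flow_rate K (s, y)).
Proof.
by move=> mK; apply: (measurableT_comp (measurable_flow_rate mK)).
Qed.

Lemma picard_lt0 K t y : t < 0 -> picard K (t, y) = 0.
Proof.
by move=> t0; rewrite /picard set_itv_ge ?bnd_simp -?ltNge//= Rintegral_set0.
Qed.

Lemma picard_lipschitz K : measurable_fun setT K -> forall y s t,
  `|picard K (t, y) - picard K (s, y)| <= B * `|t - s|.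
Proof.
move=> mK y s t; apply: time_integral_lipschitz; first exact: measurable_flow_rate_y.
by move=> u; exact: FB.
Qed.

Let admissible_picard K : measurable_fun setT K -> admissible (picard K).
Proof.
move=> mK; split.
  by apply: measurable_fun_time_integral; exact: measurable_flow_rate.
move=> [t y] /=; have := picard_lipschitz mK y 0 t.
by rewrite {2}/picard /= set_itv1 Rintegral_set1 !subr0.
Qed.

(** The rate is [2 * Lam]-Lipschitz, one [Lam] coming from [K] and one from [log_mass]. Integration
    against the weight [expR (c * s)] divides by [c], so the contraction factor is one half. *)
Let c : R := 4 * Lam.
Let c0 : 0 < c. Proof. by rewrite mulr_gt0. Qed.

Let picard_contract K K' (A : R) : admissible K -> admissible K' -> 0 <= A ->
  (forall s y, 0 <= s -> `|K (s, y) - K' (s, y)| <= A * expR (c * s)) ->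
  forall t y, 0 <= t ->
    `|picard K (t, y) - picard K' (t, y)| <= A / 2 * expR (c * t).
Proof.
move=> [mK KB] [mK' K'B] A0 KK' t y t0.
have iR K1 : measurable_fun setT K1 ->
    lam.-integrable `[0, t] (EFin \o (fun s => flow_rate K1 (s, y))).
  move=> mK1; apply: (@integrable_itv _ _ _ _ B); first exact: measurable_flow_rate_y.
  by move=> s _; exact: FB.
rewrite /picard /= -RintegralB//; [|exact: iR..].
have -> : A / 2 = (2 * Lam * A) / c by rewrite /c; field; rewrite gt_eqF.
apply: le_normr_time_integral_expR => //.
- by apply: measurable_funB; exact: measurable_flow_rate_y.
- by rewrite mulr_ge0// mulr_ge0// ltW.
apply: aeW => s /andP[s0 st].
apply: (le_trans (FL _ _ _)); rewrite /=.
rewrite [leRHS](_ : _ = Lam * (A * expR (c * s) + A * expR (c * s))); last by ring.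
rewrite ler_wpM2l ?(ltW Lam0)//.
rewrite (_ : _ - _ = (K (s, y) - K' (s, y)) - (log_mass K s - log_mass K' s)); last by ring.
apply: (le_trans (ler_normB _ _)); apply: lerD; first exact: KK'.
apply: (@ln_average_lipschitz _ _ _ _ _ _ (B * `|s|)).
- exact: measurable_section.
- exact: measurable_section.
- by move=> u; exact: KB (s, u).
- by move=> u; exact: K'B (s, u).
- by move=> u; exact: KK'.
Qed.

Let picard_seq n : R * Y -> R := iter n picard (fun=> 0).

Let admissible_seq n : admissible (picard_seq n).
Proof.
elim: n => [|n [mK _]]; last exact: admissible_picard.
by split; [exact: measurable_cst|move=> z; rewrite /picard_seq /= normr0 mulr_ge0].
Qed.

Let seq_lt0 n t y : t < 0 -> picard_seq n (t, y) = 0.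
Proof. by case: n => // n t0; exact: picard_lt0. Qed.

(** The first iterate is at most [B * t], which is below [D * expR (c * t)]. *)
Let D : R := B / c.
Let D0 : 0 <= D. Proof. by rewrite divr_ge0// ltW. Qed.

Let picard_seq_step n t y :
  `|picard_seq n.+1 (t, y) - picard_seq n (t, y)| <= D * expR (c * t) / 2 ^+ n.
Proof.
have [t0|t0] := ltP t 0.
  rewrite !seq_lt0// subrr normr0 divr_ge0 ?exprn_ge0//.
  by rewrite mulr_ge0 ?expR_ge0.
elim: n t y t0 => [|n IH] t y t0.
  rewrite expr0 divr1 subr0 (le_trans ((admissible_seq 1).2 (t, y)))//=.
  rewrite /D ger0_norm// -mulrA ler_wpM2l// mulrC ler_pdivlMr// mulrC.
  by have := expR_ge1Dx (c * t); lra.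
rewrite (_ : D * _ / _ = (D / 2 ^+ n) / 2 * expR (c * t)); last first.
  by rewrite exprS; field; rewrite expf_neq0.
apply: (picard_contract (admissible_seq n.+1) (admissible_seq n)) => //.
  by rewrite divr_ge0// exprn_ge0.
by move=> s u s0; rewrite mulrAC; exact: IH.
Qed.

(** Limits are taken pointwise with an error proportional to the weight, so no time horizon is
    fixed. Negative times are separate: the contraction is stated for [0 <= t], and before 0 all
    iterates vanish. *)
Lemma picard_fixpoint : exists K, admissible K /\ forall z, K z = picard K z.
Proof.
have /choice[K KP] : forall z, exists l : R, (picard_seq n z @[n --> \oo] --> l) /\
    forall n, `|l - picard_seq n z| <= 2 * (D * expR (c * z.1)) / 2 ^+ n.
  move=> [t y]; have [l [lc lE]] := geometric_cvg (picard_seq_step ^~ t ^~ y).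
  by exists l.
have admK : admissible K.
  split.
    apply: (@measurable_fun_cvg _ _ _ _ picard_seq) => [n|z _].
      exact: (admissible_seq n).1.
    exact: (KP z).1.
  move=> z; rewrite -subr_le0.
  apply: (@le0_of_geometric_bound _ _ (2 * (D * expR (c * z.1)))) => n.
  have h := (KP z).2 n; have h' := (admissible_seq n).2 z.
  have := ler_normD (K z - picard_seq n z) (picard_seq n z).
  by rewrite subrK; lra.
exists K; split => // -[t y]; apply/esym/eqP; rewrite -subr_eq0; apply/eqP.
have [t0|t0] := ltP t 0.
  apply/eqP; rewrite picard_lt0// -normr_le0 sub0r normrN.
  apply: (@le0_of_geometric_bound _ _ (2 * (D * expR (c * t)))) => n.
  by have := (KP (t, y)).2 n; rewrite seq_lt0// subr0.
apply/eqP; rewrite -normr_le0.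
apply: (@le0_of_geometric_bound _ _ (2 * (D * expR (c * t)))) => n.
have h1 : `|picard K (t, y) - picard_seq n.+1 (t, y)| <=
    (2 * D / 2 ^+ n) / 2 * expR (c * t).
  apply: (picard_contract admK (admissible_seq n)) => //.
    by rewrite divr_ge0 ?exprn_ge0// mulr_ge0.
  move=> s u s0; rewrite (le_trans ((KP (s, u)).2 n))//=.
  by rewrite le_eqVlt; apply/orP; left; apply/eqP; ring.
have h2 := (KP (t, y)).2 n.+1.
rewrite (_ : picard K (t, y) - K (t, y) = (picard K (t, y) - picard_seq n.+1 (t, y))
   - (K (t, y) - picard_seq n.+1 (t, y))); last by ring.
apply: (le_trans (ler_normB _ _)); apply: (le_trans (lerD h1 h2)).
rewrite le_eqVlt; apply/orP; left; apply/eqP; rewrite /= exprS.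
by field; rewrite expf_neq0.
Qed.

End flow.

Section flow_solution.
Context d (Y : measurableType d) (R : realType) (mu : probability Y R).
Notation lam := (@lebesgue_measure R).
Variables (F : Y * R -> R) (B Lam : R).
Hypotheses (mF : measurable_fun setT F) (B0 : 0 <= B) (FB : forall z, `|F z| <= B).
Hypotheses (Lam0 : 0 < Lam)
  (FL : forall y l l', `|F (y, l) - F (y, l')| <= Lam * `|l - l'|).

(** For the fixed point [K], let [z] be the logarithm of the mass of e^K and [l = K - z]; then e^l
    has mean 1 by construction. What remains is z' = m: differentiating e^z = int e^K gives int g
    e^K = m e^z, which identifies the nonlocal term of (L) with the growth rate of the log mass. *)
Lemma flow_exists : exists (l : R * Y -> R) (m : R -> R),
  [/\ measurable_fun setT l, (forall y, continuous (fun t => l (t, y))),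
      continuous m, (forall t, `|m t| <= B) &
      (forall z, `|l z| <= 2 * B * `|z.1|)] /\
  [/\ (forall t, \int[mu]_y expR (l (t, y)) = 1),
      (forall t, m t = \int[mu]_y (F (y, l (t, y)) * expR (l (t, y)))) &
      (forall t y, 0 <= t ->
        l (t, y) = \int[lam]_(s in `[0, t]) (F (y, l (s, y)) - m s))].
Proof.
have Lam_ge0 := ltW Lam0.
have [K [[mK KB] KE]] := picard_fixpoint mu mF B0 FB Lam0 FL.
have [z zdef] : exists z : R -> R, forall t, z t = ln (\int[mu]_y expR (K (t, y))) by eexists.
have [l ldef] : exists l : R * Y -> R, forall t y, l (t, y) = K (t, y) - z t.
  by exists (fun w => K w - z w.1).
have [g gdef] : exists g : R * Y -> R, forall t y, g (t, y) = F (y, l (t, y)).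
  by exists (fun w => F (w.2, l w)).
have KE' t y : K (t, y) = \int[lam]_(s in `[0, t]) g (s, y).
  by rewrite KE; apply: eq_Rintegral => s _; rewrite gdef ldef zdef.
have mKt t : measurable_fun setT (fun y => K (t, y)) by exact: measurableT_comp.
have KL y s t : `|K (t, y) - K (s, y)| <= B * `|t - s|.
  by rewrite !KE; exact: picard_lipschitz.
have K0 y : K (0, y) = 0 by rewrite KE /picard /= set_itv1 Rintegral_set1.
have zL s t : `|z t - z s| <= B * `|t - s|.
  rewrite !zdef; apply: (@ln_average_lipschitz _ _ _ _ _ _ (B * (`|s| + `|t|))) => //.
  - by move=> y; rewrite (le_trans (KB _))//= ler_wpM2l// lerDr.
  - by move=> y; rewrite (le_trans (KB _))//= ler_wpM2l// lerDl.
have z0 : z 0 = 0.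
  rewrite zdef (_ : Rintegral _ _ _ = 1) ?ln1//.
  rewrite -[RHS](average_cst mu); apply: eq_Rintegral => y _.
  by rewrite K0 expR0.
have lL y s t : `|l (t, y) - l (s, y)| <= 2 * B * `|t - s|.
  rewrite !ldef (_ : _ - _ = (K (t, y) - K (s, y)) - (z t - z s)); last by ring.
  rewrite (le_trans (ler_normB _ _))// (le_trans (lerD (KL y s t) (zL s t)))//.
  by rewrite le_eqVlt; apply/orP; left; apply/eqP; ring.
have lB w : `|l w| <= 2 * B * `|w.1|.
  by case: w => t y; have := lL y 0 t; rewrite (ldef 0) K0 z0 !subr0.
have mz : measurable_fun setT z.
  rewrite (_ : z = fun t => ln (\int[mu]_y expR (K (t, y)))); last by apply/funext.
  apply: (@measurableT_comp _ _ _ _ _ _ (@ln R)) => //.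
  have := @measurable_fun_Rintegral _ _ _ _ R mu (fun w => expR (K w)).
  by apply; exact: measurableT_comp.
have ml : measurable_fun setT l.
  rewrite (_ : l = fun w => K w - z w.1); last by apply/funext => -[]; exact: ldef.
  by apply: measurable_funB => //; exact: measurableT_comp.
have mg : measurable_fun setT g.
  rewrite (_ : g = fun w => F (w.2, l w)); last by apply/funext => -[]; exact: gdef.
  by apply: (measurableT_comp mF); apply: measurable_fun_pair => //; exact: measurable_snd.
have mlt t : measurable_fun setT (fun y => l (t, y)) by exact: measurableT_comp.
have melt t : measurable_fun setT (fun y => expR (l (t, y))) by exact: measurableT_comp.
have mgt t : measurable_fun setT (fun y => g (t, y)) by exact: measurableT_comp.
have gB w : `|g w| <= B by case: w => t y; rewrite gdef.
have gL y s t : `|g (t, y) - g (s, y)| <= Lam * (2 * B) * `|t - s|.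
  rewrite !gdef -[leRHS]mulrA; apply: (le_trans (FL _ _ _)).
  by apply: ler_wpM2l; [exact: ltW|exact: lL].
have cg y : continuous (fun t => g (t, y)).
  by apply: (@lipschitz_continuousR _ _ (Lam * (2 * B))) => s t; exact: gL.
have eKB t y : `|expR (K (t, y))| <= expR (B * `|t|) by exact: expR_bounded (KB _).
have Z_gt0 t : 0 < \int[mu]_y expR (K (t, y)).
  by apply: (@average_expR_gt0 _ _ _ _ _ (B * `|t|)) => // y; exact: KB.
have Zz t : \int[mu]_y expR (K (t, y)) = expR (z t) by rewrite zdef lnK// posrE.
have el1 t : \int[mu]_y expR (l (t, y)) = 1.
  transitivity (\int[mu]_y (expR (K (t, y)) * expR (- z t))).
    by apply: eq_Rintegral => y _; rewrite ldef expRD.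
  rewrite RintegralZr//; last first.
    by apply: integrable_probability (eKB t); exact: measurableT_comp.
  by rewrite Zz -expRD subrr expR0.
have elB t y : 0 <= expR (l (t, y)) <= expR (2 * B * `|t|).
  by rewrite expR_ge0/= ler_expR (le_trans (ler_norm _))// lB.
have elB' t y : `|expR (l (t, y))| <= expR (2 * B * `|t|) by exact: expR_bounded (lB _).
have iel t : mu.-integrable setT (EFin \o (fun y => expR (l (t, y)))).
  exact: integrable_probability (elB' t).
have [m mdef] : exists m : R -> R, forall t, m t = \int[mu]_y (g (t, y) * expR (l (t, y))) by eexists.
have mB t : `|m t| <= B.
  by rewrite mdef; apply: (le_normr_weighted_average (N := expR (2 * B * `|t|))) => //.
have mge t : measurable_fun setT (fun y => g (t, y) * expR (l (t, y))).
  exact: measurable_funM.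
have geB t y : `|g (t, y) * expR (l (t, y))| <= B * expR (2 * B * `|t|).
  by rewrite normrM ler_pM.
have cm : continuous m.
  (* Product rule: [g] moves at rate [Lam * (2 * B)] and the exponential at rate [2 * B] times a sum
     of two exponentials. These are averaged, with mean 1 each, instead of being bounded pointwise,
     so [k] is free of [t]. *)
  pose k := Lam * (2 * B) + B * (2 * (2 * B)).
  have k0 : 0 <= k by rewrite /k addr_ge0// ?mulr_ge0// ltW.
  apply: (@lipschitz_continuousR _ _ k) => s t.
  rewrite !mdef -RintegralB//; [|exact: integrable_probability (geB _)..].
  have [w wdef] : exists w : Y -> R, forall y, w y = Lam * (2 * B) * `|t - s| * expR (l (t, y)) +
    B * (2 * B * `|t - s|) * (expR (l (t, y)) + expR (l (s, y))) by eexists.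
  have gw y : `|g (t, y) * expR (l (t, y)) - g (s, y) * expR (l (s, y))| <= w y.
    rewrite wdef (_ : _ - _ = (g (t, y) - g (s, y)) * expR (l (t, y)) +
       g (s, y) * (expR (l (t, y)) - expR (l (s, y)))); last by ring.
    rewrite (le_trans (ler_normD _ _))// !normrM; apply: lerD.
      by rewrite [X in _ * X]ger0_norm ?expR_ge0// ler_wpM2r ?expR_ge0.
    rewrite -mulrA ler_pM//; apply: (le_trans (le_expR_dist _ _)).
    by rewrite ler_wpM2r ?lL// addr_ge0 ?expR_ge0.
  have mw : measurable_fun setT w.
    rewrite (_ : w = fun y => Lam * (2 * B) * `|t - s| * expR (l (t, y)) +
      B * (2 * B * `|t - s|) * (expR (l (t, y)) + expR (l (s, y)))); last exact/funext.
    apply: measurable_funD; first by apply: measurable_funM => //; exact: melt.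
    by apply: measurable_funM => //; apply: measurable_funD; exact: melt.
  have iw : mu.-integrable setT (EFin \o w).
    apply: (@integrable_probability _ _ _ _ _ (Lam * (2 * B) * `|t - s| * expR (2 * B * `|t|) +
      B * (2 * B * `|t - s|) * (expR (2 * B * `|t|) + expR (2 * B * `|s|)))) => // y.
    have /andP[e0 et] := elB t y; have /andP[f0 es] := elB s y.
    have c0 : 0 <= Lam * (2 * B) * `|t - s| by rewrite !mulr_ge0// ltW.
    rewrite wdef ger0_norm ?addr_ge0 ?mulr_ge0 ?addr_ge0//.
    apply: lerD; first exact: ler_wpM2l.
    by apply: ler_wpM2l; [rewrite !mulr_ge0|exact: lerD].
  have ig : mu.-integrable setT (EFin \o (fun y =>
      g (t, y) * expR (l (t, y)) - g (s, y) * expR (l (s, y)))).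
    apply: (@integrable_probability _ _ _ _ _ (B * expR (2 * B * `|t|) +
      B * expR (2 * B * `|s|))); first exact: measurable_funB.
    by move=> y; rewrite (le_trans (ler_normB _ _))// lerD.
  apply: (le_trans (le_normr_Rintegral _ ig)) => //.
  have := @le_Rintegral _ _ _ mu setT _ w measurableT (integrable_norm ig) iw.
  move=> /(_ (fun y _ => gw y)) /le_trans; apply.
  have -> : \int[mu]_y w y = Lam * (2 * B) * `|t - s| * 1 + B * (2 * B * `|t - s|) * (1 + 1).
    have h a1 a2 : \int[mu]_y (a1 * expR (l (t, y)) + a2 * expR (l (s, y))) = a1 + a2.
      rewrite RintegralD//; [|exact: (integrableZl _ a1 (iel t))|exact: (integrableZl _ a2 (iel s))].
      rewrite RintegralZl; [|by []|exact: iel].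
      rewrite RintegralZl; [|by []|exact: iel].
      by rewrite !el1 !mulr1.
    transitivity (\int[mu]_y ((Lam * (2 * B) * `|t - s| + B * (2 * B * `|t - s|)) * expR (l (t, y))
        + B * (2 * B * `|t - s|) * expR (l (s, y)))).
      by apply: eq_Rintegral => y _; rewrite wdef; ring.
    by rewrite h; ring.
  by rewrite le_eqVlt; apply/orP; left; apply/eqP; rewrite /k; ring.
(* The equation Z' = m Z in integrated form, by Fubini from the pointwise identity for e^K. For
   [t < 0] both sides are 1, so it holds for all [t] and can be used as an equality of functions. *)
have ZE t : expR (z t) = 1 + \int[lam]_(s in `[0, t]) (m s * expR (z s)).
  rewrite -Zz; have [t0|t0] := ltP t 0.
    rewrite set_itv_ge ?bnd_simp -?ltNge// Rintegral_set0 addr0.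
    rewrite -[RHS](average_cst mu); apply: eq_Rintegral => y _.
    by rewrite KE picard_lt0// expR0.
  have eKE y : expR (K (t, y)) = 1 + \int[lam]_(s in `[0, t]) (g (s, y) * expR (K (s, y))).
    have cK : continuous (fun s => K (s, y)) by exact: lipschitz_continuousR (KL y).
    have ceK : continuous (fun s => expR (K (s, y))).
      by move=> s; apply: continuous_comp; [exact: cK|exact: continuous_expR].
    have cgK : continuous (fun s => g (s, y) * expR (K (s, y))).
      by move=> s; apply: cvgM; [exact: cg|exact: ceK].
    have deK (s : R) : 0 < s ->
        is_derive s 1 (fun u => expR (K (u, y))) (g (s, y) * expR (K (s, y))).
      move=> s0; rewrite mulrC.
      apply: (@is_derive1_comp _ expR (fun s => K (s, y))).
      rewrite (_ : (fun s => K (s, y)) = (fun u => \int[lam]_(s in `[0, u]) g (s, y))).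
        exact: is_derive_time_integral.
      by apply/funext => u; exact: KE'.
    by rewrite (time_integral_FTC2 t0 ceK cgK deK) K0 expR0 addrC subrK.
  have mgK : measurable_fun setT (fun w => g w * expR (K w)).
    by apply: measurable_funM => //; exact: measurableT_comp.
  have gKB s y : 0 <= s <= t -> `|g (s, y) * expR (K (s, y))| <= B * expR (B * t).
    move=> /andP[s0 st]; rewrite normrM ler_pM// (le_trans (eKB _ _))// ler_expR.
    by rewrite ler_wpM2l// ger0_norm.
  have mI : measurable_fun setT (fun y => \int[lam]_(s in `[0, t]) (g (s, y) * expR (K (s, y)))).
    exact: (measurableT_comp (measurable_fun_time_integral mgK) (pair1_measurable t)).
  transitivity (\int[mu]_y (1 + \int[lam]_(s in `[0, t]) (g (s, y) * expR (K (s, y))))).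
    by apply: eq_Rintegral => y _; exact: eKE.
  rewrite RintegralD//; last 2 first.
  - exact: (@integrable_probability _ _ _ _ _ `|1|).
  - apply: (@integrable_probability _ _ _ _ _ (expR (B * `|t|) + 1)) => // y.
    rewrite (_ : Rintegral _ _ _ = expR (K (t, y)) - 1); last by rewrite eKE addrC addKr.
    by rewrite (le_trans (ler_normB _ _))// normr1 lerD.
  rewrite average_cst; congr (_ + _).
  rewrite (Rintegral_time_swap mu mgK gKB); apply: eq_Rintegral => s _.
  rewrite mdef -RintegralZr//; last exact: integrable_probability (geB s).
  apply: eq_Rintegral => y _; rewrite -mulrA -expRD.
  by rewrite ldef subrK.
have cz : continuous z by exact: lipschitz_continuousR zL.
have cez : continuous (fun s => expR (z s)).
  by move=> s; apply: continuous_comp; [exact: cz|exact: continuous_expR].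
have zE t : 0 <= t -> z t = \int[lam]_(s in `[0, t]) m s.
  have dz (s : R) : 0 < s -> is_derive s 1 z (m s).
    move=> s0.
    rewrite (_ : z = @ln R \o (fun t => 1 + \int[lam]_(s in `[0, t]) (m s * expR (z s)))); last first.
      by apply/funext => u; rewrite /= -ZE expRK.
    have -> : m s = (expR (z s))^-1 * (m s * expR (z s)).
      by field; rewrite gt_eqF// expR_gt0.
    apply: is_derive1_comp.
      by rewrite -ZE; apply: is_derive1_ln; exact: expR_gt0.
    rewrite -[X in is_derive _ _ _ X]add0r; apply: is_deriveD.
    by apply: is_derive_time_integral => // u; apply: cvgM; [exact: cm|exact: cez].
  by move=> t0; rewrite (time_integral_FTC2 t0 cz cm dz) z0 subr0.
exists l, m; split; split => //.
- by move=> y; exact: lipschitz_continuousR (lL y).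
- by move=> t; rewrite mdef; apply: eq_Rintegral => y _; rewrite gdef.
- move=> t y t0; under eq_Rintegral do rewrite -gdef.
  rewrite RintegralB//; last 2 first.
  + by apply: continuous_integrable_itv; exact: cg.
  + exact: continuous_integrable_itv.
  by rewrite -zE// ldef KE'.
Qed.

End flow_solution.

(** * Truncated pressure and its potential *)

Section monotonicity.
Context (R : realType).

Lemma ge0_derive_le (f f' : R -> R) (a b : R) : a <= b ->
  (forall x, a <= x <= b -> is_derive x 1 f (f' x)) ->
  (forall x, a <= x <= b -> 0 <= f' x) -> f a <= f b.
Proof.
rewrite le_eqVlt => /predU1P[-> //|ab] df f'0.
have [||x xab fE] := @MVT R f f' a b ab.
- by move=> x; rewrite in_itv/= => /andP[ax xb]; apply: df; rewrite !ltW.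
- apply: derivable_within_continuous => x; rewrite in_itv/= => xab.
  by have [] := df _ xab.
rewrite -subr_ge0 fE mulr_ge0 ?subr_ge0 ?(ltW ab)//; apply: f'0.
by move: xab; rewrite in_itv/= => /andP[? ?]; rewrite !ltW.
Qed.

(** A base point [e] to the left of both ends turns the signed case distinction of [oint] into a
    single difference of primitives. *)
Lemma oint_split (f : R -> R) (e c x : R) : e <= c -> e <= x ->
  (forall b, (@lebesgue_measure R).-integrable `[e, b] (EFin \o f)) ->
  oint c x f = \int[@lebesgue_measure R]_(s in `[e, x]) f s -
               \int[@lebesgue_measure R]_(s in `[e, c]) f s.
Proof.
move=> ec ex intf; rewrite /oint.
have sub u v : e <= u -> u <= v ->
    \int[@lebesgue_measure R]_(s in `[u, v]) f s =
    \int[@lebesgue_measure R]_(s in `[e, v]) f s -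
    \int[@lebesgue_measure R]_(s in `[e, u]) f s.
  move=> eu uv; rewrite Rintegral_itvB ?bnd_simp// Rintegral_itv_obnd_cbnd//.
  by apply: integrableS (intf v) => //; apply: subset_itvr; rewrite bnd_simp.
case: ifPn => [cx|]; first exact: sub.
by rewrite -ltNge => /ltW xc; rewrite sub// opprB.
Qed.

Lemma is_derive_oint (f : R -> R) (c x : R) : 0 < c -> 0 < x ->
  (forall y : R, 0 < y -> {for y, continuous f}) ->
  is_derive x 1 (fun z => oint c z f) (f x).
Proof.
(* The base point stays positive because the integrands in view are singular at 0. *)
move=> c0 x0 cf; pose e := Num.min c x / 2.
have m0 : 0 < Num.min c x by rewrite lt_min c0.
have e0 : 0 < e by rewrite /e divr_gt0.
have em : e < Num.min c x by rewrite /e ltr_pdivrMr// ltr_pMr// ltr1n.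
have ec : e < c by rewrite (lt_le_trans em)// ge_min lexx.
have ex : e < x by rewrite (lt_le_trans em)// ge_min lexx orbT.
have intf b : (@lebesgue_measure R).-integrable `[e, b] (EFin \o f).
  apply: continuous_compact_integrable; first exact: segment_compact.
  apply: continuous_in_subspaceT => y; rewrite inE/= in_itv/= => /andP[ey _].
  by apply: cf; exact: lt_le_trans ey.
have x1 : x < x + 1 by rewrite ltrDl.
have [dF F'] := @continuous_FTC1_closed R f e x (x + 1) x1 (intf (x + 1)) ex (cf x x0).
apply: (@near_eq_is_derive _ _ _ (fun z => \int[@lebesgue_measure R]_(s in `[e, z]) f s -
               \int[@lebesgue_measure R]_(s in `[e, c]) f s)).
- near=> z; rewrite (@oint_split f e)// ?(ltW ec)//.
  apply/ltW; near: z; exists (x - e); rewrite /= ?subr_gt0// => z /=.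
  by rewrite ltr_norml => /andP[_ ?]; lra.
rewrite -[f x]subr0; apply: is_deriveB.
by apply: DeriveDef; [exact: dF|rewrite -derive1E; exact: F'].
Unshelve. all: by end_near. Qed.

End monotonicity.

(** * Truncation of the density *)

Section clip.
Context (R : realType) (r : R) (r0 : 0 <= r).
Implicit Types x y : R.

Definition clip (x : R) : R := Num.min (Num.max x 0) r.

Lemma clip_itv x : 0 <= clip x <= r.
Proof. by rewrite /clip le_min r0 le_max lexx orbT/= ge_min lexx orbT. Qed.

Lemma clip_id x : 0 <= x <= r -> clip x = x.
Proof. by move=> /andP[x0 xr]; rewrite /clip max_l// min_l. Qed.

Lemma clip_gt x : r <= x -> clip x = r.
Proof. by move=> rx; rewrite /clip max_l ?(le_trans r0)// min_r. Qed.

Lemma clip_lipschitz x y : `|clip x - clip y| <= `|x - y|.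
Proof.
wlog xy : x y / x <= y.
  move=> H; have [/H//|/ltW /H] := leP x y.
  by rewrite distrC [X in _ <= X -> _]distrC.
rewrite [leRHS]ler0_norm ?subr_le0// opprB.
have E z : clip z = if z <= 0 then 0 else if z <= r then z else r.
  by rewrite /clip; case: (leP z 0) => _; [rewrite min_l|case: (leP z r)].
move: (r0) => h0; rewrite !E; case: (leP x 0) => ?; case: (leP y 0) => ?; case: (leP x r) => ?;
  case: (leP y r) => ? /=; rewrite ler_norml; apply/andP; split; lra.
Qed.

(** The derivative of a e^(-l) in l has the size of the value itself, which is at most [r] wherever
    the truncation is inactive. Hence the constant depends neither on [a] nor on the range of
    [l]. *)
Lemma clip_expR_lipschitz (a l l' : R) : 0 <= a ->
  `|clip (a * expR (- l)) - clip (a * expR (- l'))| <= r * `|l - l'|.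
Proof.
move=> a0; wlog ll' : l l' / l <= l'.
  move=> H; have [/H//|/ltW /H] := leP l l'.
  by rewrite distrC [X in _ <= _ * X -> _]distrC.
rewrite [X in _ <= _ * X]ler0_norm ?subr_le0// opprB.
set u := a * expR (- l); set u' := a * expR (- l').
have u'0 : 0 <= u' by rewrite mulr_ge0 ?expR_ge0.
have uu' : u' <= u by rewrite ler_wpM2l// ler_expR lerN2.
have u'E : u' = u * expR (- (l' - l)).
  by rewrite /u' /u -mulrA -expRD; congr (_ * expR _); ring.
have e1 : 1 - (l' - l) <= expR (- (l' - l)) by exact: expR_ge1Dx.
have u0 : 0 <= u by exact: le_trans uu'.
have [ur|ru] := leP u r.
  rewrite !clip_id ?u0 ?u'0 ?(le_trans uu')// ger0_norm ?subr_ge0//.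
  apply: (@le_trans _ _ (u * (l' - l))); last by rewrite ler_wpM2r// subr_ge0.
  rewrite u'E; have := ler_wpM2l u0 e1; lra.
rewrite (clip_gt (ltW ru)); have [u'r|ru'] := leP u' r; last first.
  by rewrite (clip_gt (ltW ru')) subrr normr0 mulr_ge0// subr_ge0.
rewrite clip_id ?u'0// ger0_norm ?subr_ge0//.
apply: (@le_trans _ _ (r - r * expR (- (l' - l)))).
  by rewrite lerD2l lerN2 u'E ler_wpM2r ?expR_ge0// ltW.
have := ler_wpM2l r0 e1; lra.
Qed.

End clip.

Section pressure.
Context (R : realType) (p : R -> R).

Lemma Hp_lipschitz r : 0 <= r -> Hp p -> exists k : R, 0 <= k /\
  forall x y, 0 <= x <= r -> 0 <= y <= r -> `|p x - p y| <= k * `|x - y|.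
Proof.
move=> r0 [cp [[p' [cp' dp]] _]].
have sub (f : R -> R) u v : 0 <= u -> {within `[0, +oo[, continuous f} ->
    {within `[u, v], continuous f}.
  move=> u0; apply: continuous_subspaceW => x; rewrite /= !in_itv/= andbT.
  by move=> /andP[ux _]; exact: le_trans ux.
have [c1 _ h1] := EVT_max r0 (sub _ _ _ (lexx 0) cp').
have [c2 _ h2] := EVT_min r0 (sub _ _ _ (lexx 0) cp').
exists (`|p' c1| + `|p' c2|); split; first exact: addr_ge0.
have kP x : 0 <= x <= r -> `|p' x| <= `|p' c1| + `|p' c2|.
  move=> xr; have := h1 x; rewrite in_itv/= xr => /(_ isT) ha.
  have := h2 x; rewrite in_itv/= xr => /(_ isT) hb.
  have := ler_norm (p' c1); have := ler_norm (- p' c2); rewrite normrN.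
  have := normr_ge0 (p' c1); have := normr_ge0 (p' c2).
  by move=> *; rewrite ler_norml; apply/andP; split; lra.
move=> x y; wlog xy : x y / x <= y.
  move=> H xr yr; have [xy|/ltW yx] := leP x y; first exact: H.
  by rewrite distrC [X in _ <= _ * X]distrC; exact: H.
move=> /andP[x0 xr] /andP[y0 yr].
move: xy; rewrite le_eqVlt => /predU1P[->|xy]; first by rewrite !subrr normr0 mulr0.
have [||z zxy pE] := @MVT R p p' x y xy.
- by move=> z; rewrite in_itv/= => /andP[xz zy]; apply: dp; exact: le_lt_trans xz.
- exact: sub.
rewrite distrC [X in _ <= _ * X]distrC pE normrM ler_wpM2r// kP//.
move: zxy; rewrite in_itv/= => /andP[xz zy].
by rewrite (le_trans x0 (ltW xz)) (le_trans (ltW zy)).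
Qed.

Lemma clip_pressure_lipschitz r : 0 <= r -> Hp p -> exists k : R, 0 < k /\
  (forall x y, `|p (clip r x) - p (clip r y)| <= k * `|x - y|) /\
  (forall a l l', 0 <= a -> `|p (clip r (a * expR (- l))) - p (clip r (a * expR (- l')))| <=
     k * `|l - l'|).
Proof.
move=> r0 /(Hp_lipschitz r0)[k [k0 kP]].
(* One constant for both estimates: [k] in the density, [k * r] in its logarithm, and 1 for strict
   positivity. *)
exists (k + k * r + 1); split; first by rewrite ltr_wpDl// addr_ge0// mulr_ge0.
split=> [x y|a l l' a0].
  apply: (le_trans (kP _ _ (clip_itv r0 x) (clip_itv r0 y))).
  apply: (le_trans (ler_wpM2l k0 (clip_lipschitz r0 x y))).
  by rewrite ler_wpM2r// -addrA lerDl addr_ge0// mulr_ge0.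
apply: (le_trans (kP _ _ (clip_itv r0 _) (clip_itv r0 _))).
apply: (le_trans (ler_wpM2l k0 (clip_expR_lipschitz r0 l l' a0))).
by rewrite mulrA ler_wpM2r//; lra.
Qed.

Lemma clip_pressure_bounded r : 0 <= r -> Hp p -> exists B : R, 0 <= B /\
  forall x, `|p (clip r x)| <= B.
Proof.
move=> r0 /(Hp_lipschitz r0)[k [k0 kP]].
exists (`|p 0| + k * r); split; first by rewrite addr_ge0// mulr_ge0.
move=> x; rewrite -[p (clip r x)](subrK (p 0)) addrC (le_trans (ler_normD _ _))// lerD2l.
have /andP[c0 cr] := clip_itv r0 x.
apply: (le_trans (kP _ _ _ _)); rewrite ?c0 ?cr ?lexx//.
by rewrite subr0 ger0_norm// ler_wpM2l.
Qed.

End pressure.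

Section pressure_potential.
Context (R : realType) (p : R -> R) (C C1 C2 rb M : R).
Hypotheses (hp : Hp p) (C0 : 0 < C) (rb0 : 0 < rb) (M0 : 0 <= M).
Hypothesis pP : forall x, 0 < x ->
  p x <= C * (x * oint rb x (fun s => p s / s ^+ 2) + C1 * x + C2).

(** The integral in P for the truncated pressure, without the factor in front: as eta J = rho0 along
    the flow, P(eta) J equals rho0 times this potential plus C1 rho0 + C2 J. *)
Definition potential (r x : R) : R := oint rb x (fun s => p (clip r s) / s ^+ 2).

Lemma is_derive_potential (r x : R) : 0 <= r -> 0 < x ->
  is_derive x 1 (potential r) (p (clip r x) / x ^+ 2).
Proof.
move=> r0 x0; apply: is_derive_oint => // y y0.
have [k [_ [kP _]]] := clip_pressure_lipschitz r0 hp.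
have cq := lipschitz_continuousR (fun s t => kP t s).
apply: cvgM; first exact: cq.
apply: cvgV; first by rewrite expf_eq0/= gt_eqF.
exact: exprn_continuous.
Qed.

Let potentialE (r x : R) : 0 < x -> rb <= r -> x <= r ->
  potential r x = oint rb x (fun s => p s / s ^+ 2).
Proof.
move=> x0 rbr xr; have r0 := ltW (lt_le_trans x0 xr); rewrite /potential /oint.
case: ifPn => [rbx|]; last rewrite -ltNge => /ltW xrb; [|congr (- _)];
  apply: eq_Rintegral => s; rewrite inE/= in_itv/= => /andP[s1 s2];
  rewrite clip_id//; apply/andP; split.
- exact: le_trans (ltW rb0) s1.
- exact: le_trans s2 xr.
- exact: le_trans (ltW x0) s1.
- exact: le_trans s2 rbr.
Qed.

(* Beyond [r] the potential increases and the truncated pressure is constant, so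
   the bound [p <= C P] at [r] propagates. *)
Lemma truncated_pressure_bound r x : rb <= r -> 0 <= p r -> C * C2 <= p r ->
  0 < x -> p (clip r x) <= C * (x * potential r x + C1 * x + C2).
Proof.
move=> rbr pr0 prC2 x0; have rp := lt_le_trans rb0 rbr; have r0 := ltW rp.
have [xr|/ltW rx] := leP x r.
  by rewrite clip_id ?(ltW x0)// potentialE//; exact: pP.
rewrite clip_gt//.
have Vmono : potential r r <= potential r x.
  apply: (@ge0_derive_le _ _ (fun x => p (clip r x) / x ^+ 2)) => // z /andP[rz zx].
    by apply: is_derive_potential => //; exact: lt_le_trans rz.
  by rewrite clip_gt// divr_ge0// sqr_ge0.
have := pP rp; rewrite -(@potentialE r r)// => h.
apply: (le_trans h); rewrite ler_pM2l//.
(* Here [C * C2 <= p r] enters: the bracket is nonnegative at [r], so its product with [x] only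
   grows beyond [r]. *)
have hV : 0 <= potential r r + C1.
  have : 0 <= C * (r * (potential r r + C1)) by move: h prC2; lra.
  by rewrite pmulr_rge0// pmulr_rge0.
have h3 : r * (potential r r + C1) <= x * (potential r x + C1).
  by apply: ler_pM => //; rewrite lerD2r.
by move: h3; lra.
Qed.

(** The bound [w0] on the initial energy has to precede the choice of [r]. With p >= -B on [0, N],
    the function V - B/x is increasing, hence x V(x) <= x V(N) + B stays bounded down to 0. As N <=
    r, the value V(N) does not see the truncation. The clause on [p 0] serves the vacuum, where x
    V(x) tends to -p(0). *)
Lemma potential_bound : exists w0 : R, - p 0 <= w0 /\
  forall r x, rb <= r -> M <= r -> 0 < x -> x <= M -> x * potential r x <= w0.
Proof.
pose N := Num.max M rb.
have rbN : rb <= N by rewrite /N le_max lexx orbT.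
have MN : M <= N by rewrite /N le_max lexx.
have N0 : 0 < N by exact: lt_le_trans rbN.
have [B [B0 BP]] := clip_pressure_bounded (ltW N0) hp.
pose V := oint rb N (fun s => p s / s ^+ 2).
exists (`|p 0| + B + M * `|V|); split.
  have := ler_norm (- p 0); rewrite normrN => h; apply: (le_trans h).
  by rewrite -addrA lerDl addr_ge0// mulr_ge0.
move=> r x rbr Mr x0 xM.
have Nr : N <= r by rewrite /N ge_max Mr.
have r0 : 0 <= r by exact: le_trans M0 Mr.
have xN : x <= N by exact: le_trans xM MN.
have mono : potential r x - B / x <= potential r N - B / N.
  apply: (@ge0_derive_le _ (fun z => potential r z - B / z)
    (fun z => p (clip r z) / z ^+ 2 + B / z ^+ 2)) => // z /andP[xz zN].
    have z0 : 0 < z by exact: lt_le_trans xz.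
    apply: is_derive_eq.
      apply: is_deriveB; first exact: is_derive_potential.
      apply: is_deriveZ; apply: is_deriveV; by rewrite gt_eqF.
    by rewrite /GRing.scale/=; field; rewrite gt_eqF.
  have z0 : 0 < z by exact: lt_le_trans xz.
  rewrite -mulrDl divr_ge0 ?sqr_ge0//.
  have zi : 0 <= z <= N by rewrite (ltW z0).
  have zi' : 0 <= z <= r by rewrite (ltW z0) (le_trans zN).
  have := BP z; rewrite !clip_id// ler_norml => /andP[? _]; lra.
have VN : potential r N = V by rewrite potentialE.
have h : x * potential r x <= x * (V + B / x).
  rewrite ler_pM2l// -VN; have : 0 <= B / N by rewrite divr_ge0// ltW.
  by move: mono; lra.
apply: (le_trans h); rewrite mulrDr mulrCA divff ?gt_eqF// mulr1.
have : x * V <= M * `|V|.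
  rewrite (le_trans (ler_norm _))// normrM (gtr0_norm x0).
  by rewrite ler_wpM2r.
have := normr_ge0 (p 0); lra.
Qed.

(* [x P(x) -> -p(0)] as [x -> 0], which turns [p <= C P] into this inequality.
   If it failed, [V + (p(0) - eps) / x] would be nondecreasing near [0] and
   nevertheless blow up there. *)
Lemma pressure_at_vacuum : p 0 <= C * (C2 - p 0).
Proof.
rewrite leNgt; apply/negP => lt0.
pose D := p 0 / C - C2 + p 0.
have D0 : 0 < D.
  rewrite /D -(pmulr_rgt0 _ C0) (_ : C * _ = p 0 - C * (C2 - p 0)) ?subr_gt0//.
  by field; rewrite gt_eqF.
(* The gap [D] is split in two: this choice makes [eps / C + 2 * eps] one half, and the other half
   absorbs [C1 * x]. *)
pose eps := D / (2 * (2 + C^-1)).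
have Ci0 : 0 < C^-1 by rewrite invr_gt0.
have e0 : 0 < eps by rewrite divr_gt0// mulr_gt0// addr_gt0.
have epsE : eps / C + 2 * eps = D / 2.
  have : eps * (2 * (2 + C^-1)) = D by rewrite /eps divfK// gt_eqF// mulr_gt0// addr_gt0.
  by move=> E; lra.
have [k [k0 kP]] := Hp_lipschitz (ltW rb0) hp.
(* The three entries keep the truncation at [rb] inactive, p within [eps] of [p 0], and [C1 * x]
   below [D / 2]. *)
pose del := Num.min rb (Num.min (eps / (k + 1)) (D / (2 * (`|C1| + 1)))).
have k1 : 0 < k + 1 by rewrite ltr_wpDl.
have C11 : 0 < `|C1| + 1 by rewrite ltr_wpDl.
have del0 : 0 < del by rewrite /del !lt_min rb0 (divr_gt0 e0 k1) divr_gt0 ?mulr_gt0.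
have del_rb : del <= rb by rewrite /del ge_min lexx.
have del_k : (k + 1) * del <= eps.
  by rewrite mulrC -ler_pdivlMr// /del !ge_min lexx orbT.
have del_C : (`|C1| + 1) * del <= D / 2.
  rewrite mulrC -ler_pdivlMr// -mulrA -invfM /del !ge_min.
  by rewrite lexx !orbT.
have p_lb x : 0 < x -> x <= del -> p 0 - eps <= p x.
  move=> x0 xd; have := kP 0 x; rewrite lexx (ltW rb0) (ltW x0) (le_trans xd)//.
  move=> /(_ isT isT); rewrite sub0r normrN (gtr0_norm x0).
  have : k * x <= eps.
    apply: le_trans del_k; apply: ler_pM => //; [exact: ltW|by rewrite lerDl].
  by rewrite ler_norml => h /andP[_ ?]; lra.
have V_lb x : 0 < x -> x <= del -> - p 0 + 2 * eps <= x * potential rb x.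
  move=> x0 xd; rewrite potentialE ?(le_trans xd)//.
  have := pP x0; rewrite -ler_pdivrMl// => h.
  have h1 : (p 0 - eps) / C <= C^-1 * p x.
    by rewrite mulrC ler_pM2l//; exact: p_lb.
  have h2 : C1 * x <= D / 2.
    apply: le_trans del_C; apply: (le_trans (ler_norm _)); rewrite normrM (gtr0_norm x0).
    by apply: ler_pM => //; [exact: ltW|rewrite lerDl].
  have h3 : (p 0 - eps) / C = p 0 / C - eps / C by ring.
  have h4 : D = p 0 / C - C2 + p 0 by [].
  by lra.
have [e eE] : exists e, e = eps - p 0 by eexists.
pose c := potential rb del - e / del.
have mono x : 0 < x -> x <= del -> potential rb x - e / x <= c.
  move=> x0 xd; apply: (@ge0_derive_le _ (fun z => potential rb z - e / z)
    (fun z => p (clip rb z) / z ^+ 2 + e / z ^+ 2)) => // z /andP[xz zd].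
    have z0 : 0 < z by exact: lt_le_trans xz.
    apply: is_derive_eq.
      apply: is_deriveB; first exact: (is_derive_potential (ltW rb0) z0).
      apply: is_deriveZ; apply: is_deriveV; by rewrite gt_eqF.
    by rewrite /GRing.scale/=; field; rewrite gt_eqF.
  have z0 : 0 < z by exact: lt_le_trans xz.
  rewrite -mulrDl divr_ge0 ?sqr_ge0// clip_id ?(ltW z0) ?(le_trans zd)//.
  by rewrite eE; have := p_lb z z0 zd; lra.
(* At this [x] one has [x * c < eps], so the upper bound [eps - p 0 + x * c] falls below the lower
   bound [2 * eps - p 0]. *)
pose x := Num.min del (eps / (`|c| + 1)).
have c1 : 0 < `|c| + 1 by rewrite ltr_wpDl.
have x0 : 0 < x by rewrite /x lt_min del0 divr_gt0.
have xd : x <= del by rewrite /x ge_min lexx.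
have xc : (`|c| + 1) * x <= eps by rewrite mulrC -ler_pdivlMr// /x ge_min lexx orbT.
have := V_lb x x0 xd.
have h : x * potential rb x + (p 0 - eps) <= x * c.
  have := mono x x0 xd; rewrite -(ler_pM2l x0) mulrBr mulrCA divff ?gt_eqF// mulr1.
  by rewrite eE opprB.
have h2 : x * c <= `|c| * x by rewrite mulrC ler_wpM2r ?ler_norm// ltW.
by move: xc; rewrite mulrDl mul1r; lra.
Qed.

End pressure_potential.

(** * Energy bound and existence *)

Section barrier.
Context (R : realType).
Implicit Types (f : R -> R) (c t : R).

(** Stopping at the last time below the level makes the inequality strict on all of []s, t]], so
    information available only above [c] can be used on the whole interval. *)
Lemma last_crossing f c t : continuous f -> 0 <= t -> f 0 <= c -> c < f t ->
  exists s, [/\ 0 <= s < t, f s = c & forall u, s < u <= t -> c < f u].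
Proof.
move=> cf t0 f0 ft.
pose S := [set s | 0 <= s <= t /\ f s <= c].
have S0 : S 0 by split => //; rewrite lexx.
have hS : has_sup S by split; [exists 0|exists t => s [/andP[]]].
set s := sup S.
have ubS u : S u -> u <= s by move=> Su; exact: sup_upper_bound.
have s0 : 0 <= s by exact: ubS.
have st : s <= t by apply: ge_sup => [|u [/andP[]]//]; exists 0.
have near_f e : 0 < e -> exists2 del, 0 < del & forall u, `|s - u| < del -> `|f s - f u| < e.
  move=> e0; have /cvgrPdist_lt /(_ e e0) := cf s.
  by case=> del /= del0 h; exists del.
have fs_le : f s <= c.
  rewrite leNgt; apply/negP => fs.
  have [del del0 h] := near_f (f s - c) ltac:(by rewrite subr_gt0).
  have [u Su su] := sup_adherent del0 hS.
  have := h u; rewrite ger0_norm ?subr_ge0 ?ubS// => /(_ ltac:(rewrite -/s in su; lra)).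
  by rewrite ltr_norml => /andP[_]; case: Su => _ ?; lra.
have slt : s < t.
  by rewrite lt_neqAle st andbT; apply/negP => /eqP E; move: fs_le; rewrite E leNgt ft.
have after u : s < u <= t -> c < f u.
  move=> /andP[su ut]; rewrite ltNge; apply/negP => fu.
  have : u <= s by apply: ubS; split => //; rewrite ut (le_trans s0)// ltW.
  by rewrite leNgt su.
exists s; split => //; first by rewrite s0.
apply/le_anti; rewrite fs_le /= leNgt; apply/negP => fs.
have [del del0 h] := near_f (c - f s) ltac:(by rewrite subr_gt0).
pose u := Num.min t (s + del / 2).
have su : s < u by rewrite /u lt_min slt ltrDl divr_gt0.
have ut : u <= t by rewrite /u ge_min lexx.
have ud : u <= s + del / 2 by rewrite /u ge_min lexx orbT.
have := h u; rewrite ltr0_norm ?subr_lt0// opprB => /(_ ltac:(lra)).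
rewrite ltr_norml => /andP[? _]; have := after u; rewrite su ut => /(_ isT).
lra.
Qed.

Lemma barrier f (f' : R -> R) c t : continuous f ->
  (forall s : R, 0 < s -> is_derive s 1 f (f' s)) ->
  (forall s : R, 0 < s -> c < f s -> f' s <= 0) -> f 0 <= c -> 0 <= t -> f t <= c.
Proof.
move=> cf df f'0 f0 t0; rewrite leNgt; apply/negP => ft.
have [s [/andP[s0 st] fs after]] := last_crossing cf t0 f0 ft.
have [||u ust fE] := @MVT R f f' s t st.
- by move=> u; rewrite in_itv/= => /andP[su _]; apply: df; exact: le_lt_trans su.
- exact: continuous_subspaceT.
move: ust; rewrite in_itv/= => /andP[su ut].
have : f t - f s <= 0.
  rewrite fE mulr_le0_ge0 ?subr_ge0 ?(ltW st)//; apply: f'0.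
    exact: le_lt_trans su.
  by apply: after; rewrite su ltW.
by rewrite fs subr_le0 leNgt ft.
Qed.

End barrier.

Section existence.
Context d (Y : measurableType d) (R : realType) (mu : probability Y R).
Notation lam := (@lebesgue_measure R).
Variables (p : R -> R) (a : Y -> R) (M : R).
Hypotheses (hp : Hp p) (ma : measurable_fun setT a) (aM : forall y, 0 <= a y <= M).
Hypothesis M0 : 0 <= M.

(* The truncation height: the potential bounds the pressure mean by [K], and the
   density cannot cross a level [r] where [p r > K]. *)
Lemma exists_truncation (N K : R) : 0 <= N -> exists r, N <= r /\ K < p r.
Proof.
move=> N0; have [B [B0 BP]] := clip_pressure_bounded N0 hp.
have [_ [_ [ub _]]] := hp.
have [x [x0 px]] := ub (B + `|K|).
exists x; split; last first.
  by apply: le_lt_trans px; have := ler_norm K; lra.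
rewrite leNgt; apply/negP => xN.
have xi : 0 <= x <= N by rewrite x0 ltW.
have := BP x; rewrite (clip_id xi) ler_norml => /andP[_ h]; move: px.
by have := normr_ge0 K; lra.
Qed.

(** * Energy dissipation and the density bound along the truncated flow *)

Section truncated_flow.
Variables (C C1 C2 rb w0 r : R) (l : R * Y -> R) (m : R -> R) (B : R).
Hypotheses (C0 : 0 < C) (rb0 : 0 < rb).
Hypothesis pP : forall x : R, 0 < x ->
  p x <= C * (x * oint rb x (fun s => p s / s ^+ 2) + C1 * x + C2).
Hypothesis w0p : - p 0 <= w0.
Hypothesis w0P : forall x : R, 0 < x -> x <= M -> x * potential p rb r x <= w0.
Hypotheses (rbr : rb <= r) (Mr : M <= r) (prK : C * (w0 + `|C1| * M + C2) < p r).
Hypotheses (pr0 : 0 <= p r) (prC2 : C * C2 <= p r).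

Let q x := p (clip r x).
Let eta (z : R * Y) := a z.2 * expR (- l z).

Hypotheses (ml : measurable_fun setT l) (cl : forall y, continuous (fun t => l (t, y))).
Hypotheses (cm : continuous m) (mB : forall t, `|m t| <= B).
Hypothesis lB : forall z, `|l z| <= 2 * B * `|z.1|.
Hypothesis l1 : forall t, \int[mu]_y expR (l (t, y)) = 1.
Hypothesis mE : forall t, m t = \int[mu]_y (q (eta (t, y)) * expR (l (t, y))).
Hypothesis lE : forall t y, 0 <= t ->
  l (t, y) = \int[lam]_(s in `[0, t]) (q (eta (s, y)) - m s).
Hypotheses (cq : continuous q) (B0 : 0 <= B) (qB : forall x, `|q x| <= B).

Let sigma (z : R * Y) := q (eta z) - m z.1.

Let r0 : 0 <= r. Proof. exact: le_trans M0 Mr. Qed.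

Let l0 y : l (0, y) = 0.
Proof. by apply/eqP; rewrite -normr_le0 (le_trans (lB _))//= normr0 mulr0. Qed.

Let ceta y : continuous (fun t => eta (t, y)).
Proof.
move=> t; rewrite /eta /=; apply: cvgMr; apply: continuous_comp; last exact: continuous_expR.
by apply: cvgN; exact: cl.
Qed.

Let csigma y : continuous (fun t => sigma (t, y)).
Proof.
move=> t; rewrite /sigma /=; apply: cvgB; last exact: cm.
by apply: continuous_comp; [exact: ceta|exact: cq].
Qed.

Let cJ y : continuous (fun t => expR (l (t, y))).
Proof. by move=> t; apply: continuous_comp; [exact: cl|exact: continuous_expR]. Qed.

Let dl (t : R) y : 0 < t -> is_derive t 1 (fun t => l (t, y)) (sigma (t, y)).
Proof.
move=> t0; apply: (@near_eq_is_derive _ _ _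
  (fun u : R => \int[lam]_(s in `[0, u]) sigma (s, y))).
  near=> u; rewrite lE//; apply/ltW; near: u; exists t => // u /=.
  by rewrite ltr_norml => /andP[_ ?]; lra.
by apply: is_derive_time_integral.
Unshelve. all: by end_near. Qed.

Let dJ (t : R) y : 0 < t ->
  is_derive t 1 (fun t => expR (l (t, y))) (sigma (t, y) * expR (l (t, y))).
Proof.
move=> t0; rewrite mulrC.
by apply: (@is_derive1_comp _ expR (fun t => l (t, y))); exact: dl.
Qed.

Let deta (t : R) y : 0 < t ->
  is_derive t 1 (fun t => eta (t, y)) (- (eta (t, y) * sigma (t, y))).
Proof.
move=> t0; have -> : - (eta (t, y) * sigma (t, y)) =
    a y *: (expR (- l (t, y)) * - sigma (t, y)).
  by rewrite /eta /GRing.scale /=; ring.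
rewrite /eta /=; apply: is_deriveZ.
apply: (@is_derive1_comp _ expR (fun t => - l (t, y))).
by apply: is_deriveN; exact: dl.
Qed.

Lemma truncated_density_integral t y : 0 <= t ->
  eta (t, y) = a y - \int[lam]_(s in `[0, t]) (eta (s, y) * sigma (s, y)).
Proof.
move=> t0.
have c1 : continuous (fun s => - (eta (s, y) * sigma (s, y))).
  by move=> s; apply: cvgN; apply: cvgM; [exact: ceta|exact: csigma].
have c2 : continuous (fun s => eta (s, y) * sigma (s, y)).
  by move=> s; apply: cvgM; [exact: ceta|exact: csigma].
have := time_integral_FTC2 t0 (@ceta y) c1 (fun s s0 => deta y s0).
have -> : eta (0, y) = a y by rewrite /eta /= l0 oppr0 expR0 mulr1.
have -> : \int[lam]_(s in `[0, t]) - (eta (s, y) * sigma (s, y)) =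
    - \int[lam]_(s in `[0, t]) (eta (s, y) * sigma (s, y)).
  under eq_Rintegral do rewrite -mulN1r.
  by rewrite RintegralZl ?mulN1r//; exact: continuous_integrable_itv.
by move=> h; lra.
Qed.

(** The energy lost at the point [y] up to time [t]. It has no sign pointwise; only its average over
    [Y] is nonnegative. *)
Let X (z : R * Y) := \int[lam]_(s in `[0, z.1]) (q (eta (s, z.2)) * sigma (s, z.2) * expR (l (s, z.2))).

Let cX y : continuous (fun s => q (eta (s, y)) * sigma (s, y) * expR (l (s, y))).
Proof.
move=> s; apply: cvgM; last exact: cJ.
apply: cvgM; last exact: csigma.
by apply: continuous_comp; [exact: ceta|exact: cq].
Qed.

Let pressure_le_energy t y : 0 <= t ->
  q (eta (t, y)) * expR (l (t, y)) <=
  C * (w0 - X (t, y) + `|C1| * M + C2 * expR (l (t, y))).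
Proof.
move=> t0; have /andP[a0 aM'] := aM y.
have J0 := expR_gt0 (l (t, y)).
move: a0; rewrite le_eqVlt => /predU1P[a0|a0].
  have e0 s : eta (s, y) = 0 by rewrite /eta /= -a0 mul0r.
  have q0 : q 0 = p 0 by rewrite /q clip_id// lexx r0.
  have -> : X (t, y) = p 0 * (expR (l (t, y)) - 1).
    rewrite /X /=.
    transitivity (\int[lam]_(s in `[0, t]) (p 0 * (sigma (s, y) * expR (l (s, y))))).
      by apply: eq_Rintegral => s _; rewrite e0 q0 mulrA.
    have csJ : continuous (fun s => sigma (s, y) * expR (l (s, y))).
      by move=> s; apply: cvgM; [exact: csigma|exact: cJ].
    rewrite RintegralZl//; last exact: continuous_integrable_itv.
    by rewrite (time_integral_FTC2 t0 (@cJ y) csJ (fun s s0 => dJ y s0)) l0 expR0.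
  rewrite e0 q0.
  have h1 : p 0 * expR (l (t, y)) <= C * (C2 - p 0) * expR (l (t, y)).
    by rewrite ler_pM2r//; exact: (pressure_at_vacuum hp C0 rb0 pP).
  have h2 : 0 <= C * (w0 + p 0 + `|C1| * M).
    by rewrite mulr_ge0 ?(ltW C0)// addr_ge0 ?mulr_ge0//; have := w0p; lra.
  by lra.
have eta0 s : 0 < eta (s, y) by rewrite /eta /= mulr_gt0// expR_gt0.
have etaJ s : eta (s, y) * expR (l (s, y)) = a y.
  by rewrite /eta /= -mulrA -expRD addNr expR0 mulr1.
pose V x := potential p rb r x.
have dV (s : R) : 0 < s -> is_derive s 1 (fun s => a y * V (eta (s, y)))
    (- (q (eta (s, y)) * sigma (s, y) * expR (l (s, y)))).
  move=> s0.
  have -> : - (q (eta (s, y)) * sigma (s, y) * expR (l (s, y))) =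
     a y *: (q (eta (s, y)) / eta (s, y) ^+ 2 * - (eta (s, y) * sigma (s, y))).
    rewrite /GRing.scale /= -(etaJ s); field.
    by rewrite gt_eqF.
  apply: is_deriveZ.
  apply: (@is_derive1_comp _ V (fun s => eta (s, y))); last exact: deta.
  exact: (is_derive_potential hp rb0).
have cV : continuous (fun s => a y * V (eta (s, y))).
  move=> s; apply: cvgMr; apply: (@continuous_comp _ _ _ (fun s => eta (s, y)) V).
    exact: ceta.
  apply: differentiable_continuous; apply/derivable1_diffP.
  by have [] := @is_derive_potential _ _ _ hp rb0 r (eta (s, y)) r0 (eta0 s).
have c1 : continuous (fun s => - (q (eta (s, y)) * sigma (s, y) * expR (l (s, y)))).
  by move=> s; apply: cvgN; exact: cX.
have := time_integral_FTC2 t0 cV c1 dV.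
have -> : \int[lam]_(s in `[0, t]) - (q (eta (s, y)) * sigma (s, y) * expR (l (s, y))) =
    - X (t, y).
  under eq_Rintegral do rewrite -mulN1r.
  by rewrite RintegralZl ?mulN1r//; apply: continuous_integrable_itv; exact: cX.
have -> : eta (0, y) = a y by rewrite /eta /= l0 oppr0 expR0 mulr1.
have := w0P a0 aM'; rewrite -/(V (a y)) => hw hE.
have := truncated_pressure_bound hp C0 rb0 pP rbr pr0 prC2 (eta0 t).
rewrite -/(V _) -/(q _) -(ler_pM2r J0) => /le_trans; apply.
rewrite -mulrA ler_pM2l// !mulrDl.
have -> : eta (t, y) * V (eta (t, y)) * expR (l (t, y)) = a y * V (eta (t, y)).
  by rewrite -(etaJ t); ring.
have -> : C1 * eta (t, y) * expR (l (t, y)) = C1 * a y by rewrite -mulrA etaJ.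
have : C1 * a y <= `|C1| * M.
  rewrite (le_trans (ler_norm _))// normrM (gtr0_norm a0).
  by rewrite ler_wpM2l.
by lra.
Qed.

Let meta : measurable_fun setT eta.
Proof.
apply: measurable_funM; first by apply: (measurableT_comp ma); exact: measurable_snd.
by apply: measurableT_comp => //; exact: measurable_funN.
Qed.

Let mq : measurable_fun setT (fun z => q (eta z)).
Proof. exact: (measurableT_comp (continuous_measurable_fun cq) meta). Qed.

Let msigma : measurable_fun setT sigma.
Proof.
apply: (measurable_funB mq).
exact: (measurableT_comp (continuous_measurable_fun cm) measurable_fst).
Qed.

Let mJ : measurable_fun setT (fun z => expR (l z)).
Proof. exact: measurableT_comp. Qed.

Let sigmaB z : `|sigma z| <= 2 * B.
Proof.
rewrite /sigma (le_trans (ler_normB _ _))//.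
by rewrite mulrDl mul1r lerD.
Qed.

Let JB t y : `|expR (l (t, y))| <= expR (2 * B * `|t|).
Proof. by apply: expR_bounded; exact: lB. Qed.

Let section_t (f : R * Y -> R) t : measurable_fun setT f ->
  measurable_fun setT (fun y => f (t, y)).
Proof. by move=> mf; exact: (measurableT_comp mf). Qed.

Let integrable_weighted (f : R * Y -> R) (N : R) t : measurable_fun setT f ->
  (forall z, `|f z| <= N) ->
  mu.-integrable setT (EFin \o (fun y => f (t, y) * expR (l (t, y)))).
Proof.
move=> mf fN; apply: (@integrable_probability _ _ _ _ _ (N * expR (2 * B * `|t|))).
  by apply: measurable_funM; [exact: section_t|exact: (@section_t (fun z => expR (l z)))].
by move=> y; rewrite normrM ler_pM.
Qed.

Let average_sigma0 t : \int[mu]_y (sigma (t, y) * expR (l (t, y))) = 0.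
Proof.
transitivity (\int[mu]_y (q (eta (t, y)) * expR (l (t, y)) - m t * expR (l (t, y)))).
  by apply: eq_Rintegral => y _; rewrite /sigma mulrBl.
rewrite RintegralB//; last 2 first.
- exact: (@integrable_weighted (fun z => q (eta z)) B t mq (fun z => qB _)).
- apply: (@integrable_weighted (fun z => m t) B) => //; exact: measurable_cst.
rewrite -mE RintegralZl//; first by rewrite l1 mulr1 subrr.
apply: (@integrable_probability _ _ _ _ _ (expR (2 * B * `|t|))) => //.
exact: (@section_t (fun z => expR (l z))).
Qed.

(* The dissipation: since [sigma] has weighted mean zero, the mean of [q sigma]
   is that of [sigma ^+ 2]. *)
Let dissipation_ge0 t :
  0 <= \int[mu]_y (q (eta (t, y)) * sigma (t, y) * expR (l (t, y))).
Proof.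
have -> : \int[mu]_y (q (eta (t, y)) * sigma (t, y) * expR (l (t, y))) =
    \int[mu]_y (sigma (t, y) * sigma (t, y) * expR (l (t, y))) +
    \int[mu]_y (m t * (sigma (t, y) * expR (l (t, y)))).
  rewrite -RintegralD//.
  - by apply: eq_Rintegral => y _; rewrite {3}/sigma /=; ring.
  - apply: (@integrable_weighted (fun z => sigma z * sigma z) (2 * B * (2 * B))).
      exact: measurable_funM.
    by move=> z; rewrite normrM ler_pM.
  - rewrite (_ : (fun y => _) = (fun y => (m t * sigma (t, y)) * expR (l (t, y)))).
      apply: (@integrable_weighted (fun z => m t * sigma z) (B * (2 * B))).
        by apply: measurable_funM => //; exact: measurable_cst.
      by move=> z; rewrite normrM ler_pM.
    by apply/funext => y; rewrite mulrA.
rewrite RintegralZl//; last exact: (@integrable_weighted sigma (2 * B) t msigma sigmaB).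
rewrite average_sigma0 mulr0 addr0; apply: Rintegral_ge0 => y _.
by rewrite mulr_ge0 ?expR_ge0// -expr2 sqr_ge0.
Qed.

(** In the average of the pointwise energy bound, [X] drops out by its sign and J has mean 1, so
    nothing depends on [t]. This is the source of a density bound uniform in time. *)
Lemma mean_pressure_le t : 0 <= t -> m t <= C * (w0 + `|C1| * M + C2).
Proof.
move=> t0.
pose G (z : R * Y) := q (eta z) * sigma z * expR (l z).
have mG : measurable_fun setT G by do 2?apply: measurable_funM.
have GB (s : R) y : 0 <= s <= t -> `|G (s, y)| <= B * (2 * B) * expR (2 * B * t).
  move=> /andP[s0 st]; rewrite /G !normrM; apply: ler_pM => //.
    by apply: ler_pM.
  rewrite (le_trans (JB _ _))// ler_expR ler_wpM2l ?mulr_ge0//.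
  by rewrite ger0_norm.
have XE y : X (t, y) = \int[lam]_(s in `[0, t]) G (s, y) by [].
have mX : measurable_fun setT (fun y => X (t, y)).
  exact: (measurableT_comp (measurable_fun_time_integral mG) (pair1_measurable t)).
have iX : mu.-integrable setT (EFin \o (fun y => X (t, y))).
  apply: (@integrable_probability _ _ _ _ _ (B * (2 * B) * expR (2 * B * t) * t)) => // y.
  have mGy : measurable_fun setT (fun s => G (s, y)).
    exact: (measurableT_comp mG (pair2_measurable y)).
  have iG := integrable_itv mGy (fun s st => @GB s y st).
  rewrite XE (le_trans (le_normr_Rintegral _ iG))//.
  have -> : B * (2 * B) * expR (2 * B * t) * t =
      \int[lam]_(s in `[0, t]) (B * (2 * B) * expR (2 * B * t)).
    rewrite Rintegral_cst//= lebesgue_measure_itv/= lte_fin; case: ifPn => [_|].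
      by rewrite /= subr0.
    by rewrite -leNgt => t0'; rewrite (@le_anti _ _ t 0) ?t0 ?t0'// mulr0.
  apply: le_Rintegral => //.
  - exact: integrable_norm iG.
  - by apply: (@integrable_itv _ _ _ _ `|B * (2 * B) * expR (2 * B * t)|) => //.
  - by move=> s /=; rewrite in_itv/= => st; exact: GB.
have X0 : 0 <= \int[mu]_y X (t, y).
  rewrite (Rintegral_time_swap mu mG GB); apply: Rintegral_ge0 => s _.
  exact: dissipation_ge0.
have iJ : mu.-integrable setT (EFin \o (fun y => expR (l (t, y)))).
  apply: (@integrable_probability _ _ _ _ _ (expR (2 * B * `|t|))) => //.
  exact: (@section_t (fun z => expR (l z))).
pose c1 := C * (w0 + `|C1| * M).
have ic : mu.-integrable setT (EFin \o (fun y : Y => c1)).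
  exact: (@integrable_probability _ _ _ _ _ `|c1|).
have iCX := integrableZl measurableT (- C) iX.
have iCJ := integrableZl measurableT (C * C2) iJ.
have icX : mu.-integrable setT (EFin \o (fun y => c1 + - C * X (t, y))).
  exact: (integrableD measurableT ic iCX).
rewrite mE.
have h : \int[mu]_y (q (eta (t, y)) * expR (l (t, y))) <=
    \int[mu]_y (c1 + - C * X (t, y) + C * C2 * expR (l (t, y))).
  apply: le_Rintegral => //.
  - exact: (@integrable_weighted (fun z => q (eta z)) B t mq (fun z => qB _)).
  - exact: (integrableD measurableT icX iCJ).
  - move=> y _; apply: (le_trans (pressure_le_energy y t0)).
    by rewrite le_eqVlt; apply/orP; left; apply/eqP; rewrite /c1; ring.
apply: (le_trans h).
rewrite RintegralD// RintegralD// average_cst RintegralZl// RintegralZl// l1.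
have h2 : 0 <= C * \int[mu]_y X (t, y) by rewrite mulr_ge0// ltW.
by rewrite /c1; lra.
Qed.

(** Above [r] the truncated pressure equals [p r], which exceeds its mean, so the density cannot
    rise there. Hence the truncation is never active along the flow. *)
Lemma truncated_density_itv t y : 0 <= t -> 0 <= eta (t, y) <= r.
Proof.
move=> t0; have /andP[a0 ay] := aM y; apply/andP; split.
  by rewrite /eta /= mulr_ge0 ?expR_ge0.
apply: (@barrier _ (fun t => eta (t, y)) (fun t => - (eta (t, y) * sigma (t, y)))) => //.
- by move=> s s0; exact: deta.
- move=> s s0 es; rewrite oppr_le0 mulr_ge0//; first exact: le_trans r0 (ltW es).
  rewrite /sigma /q clip_gt ?(ltW es)// subr_ge0.
  by apply: (le_trans (mean_pressure_le (ltW s0))); exact: ltW.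
- by rewrite /eta /= l0 oppr0 expR0 mulr1 (le_trans ay).
Qed.

End truncated_flow.

(** The truncated pressure [q] is exposed because it is continuous on the whole line, while agreeing
    with [p] on the range of eta. *)
Lemma lagrangian_exists : exists r : R, 0 <= r /\
  exists (q : R -> R) (l : R * Y -> R) (m : R -> R) (B : R),
  let eta (z : R * Y) := a z.2 * expR (- l z) in
  [/\ continuous q, (forall x, 0 <= x <= r -> q x = p x), measurable_fun setT l,
      continuous m & (forall x, `|q x| <= B) /\ (forall t, `|m t| <= B)] /\
  [/\ (forall t y, 0 <= t -> 0 <= eta (t, y) <= r),
      (forall t, m t = \int[mu]_y (q (eta (t, y)) * expR (l (t, y)))),
      (forall t y, 0 <= t -> l (t, y) = \int[lam]_(s in `[0, t]) (q (eta (s, y)) - m s)) &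
      (forall t y, 0 <= t -> eta (t, y) =
        a y - \int[lam]_(s in `[0, t]) (eta (s, y) * (q (eta (s, y)) - m s)))].
Proof.
have [_ [_ [_ [C [C1 [C2 [rb [C0 [rb0 hP]]]]]]]]] := hp.
have pP (x : R) : 0 < x -> p x <= C * (x * oint rb x (fun s => p s / s ^+ 2) + C1 * x + C2).
  by move=> x0; have [_ []] := hP x x0.
have [w0 [w0p w0P]] := potential_bound hp rb0 M0.
pose K := C * (w0 + `|C1| * M + C2).
have N0 : 0 <= Num.max M rb by rewrite le_max M0.
(* A single strict inequality supplies [K < p r], [0 <= p r] and [C * C2 <= p r]. *)
have [r [Nr pr]] := exists_truncation (`|K| + `|C * C2|) N0.
move: Nr; rewrite ge_max => /andP[Mr rbr].
have r0 : 0 <= r by exact: le_trans Mr.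
have Kpr : K < p r.
  by apply: le_lt_trans pr; rewrite (le_trans (ler_norm _))// lerDl.
have pr0 : 0 <= p r by apply/ltW; apply: le_lt_trans pr; exact: addr_ge0.
have prC2 : C * C2 <= p r.
  by apply/ltW; apply: le_lt_trans pr; rewrite (le_trans (ler_norm _))// lerDr.
have [k [k0 [kP kE]]] := clip_pressure_lipschitz r0 hp.
have [B [B0 BP]] := clip_pressure_bounded r0 hp.
have cq : continuous (fun x => p (clip r x)).
  by apply: lipschitz_continuousR => s t; exact: kP.
pose F (w : Y * R) := p (clip r (a w.1 * expR (- w.2))).
have mF : measurable_fun setT F.
  apply: (@measurableT_comp _ _ _ _ _ _ (fun x => p (clip r x))).
    exact: continuous_measurable_fun.
  apply: measurable_funM; first by apply: (measurableT_comp ma); exact: measurable_fst.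
  apply: measurableT_comp => //; apply: measurable_funN; exact: measurable_snd.
have FL y l l' : `|F (y, l) - F (y, l')| <= k * `|l - l'|.
  by apply: kE; have /andP[] := aM y.
have [l [m [[ml cl cm mB lB] [l1 mE lE]]]] :=
  flow_exists mu mF B0 (fun w => BP _) k0 FL.
have w0P' (x : R) : 0 < x -> x <= M -> x * potential p rb r x <= w0 by exact: w0P.
exists r; split => //; exists (fun x => p (clip r x)), l, m, B => eta.
split; first by split => // x xr; rewrite clip_id.
split => //.
- move=> t y t0.
  exact: (truncated_density_itv C0 rb0 pP w0p w0P' rbr Mr Kpr pr0 prC2 ml cl cm mB lB l1 mE lE cq B0 BP).
- move=> t y t0.
  exact: (truncated_density_integral cl cm lB lE cq).
Qed.

End existence.

(** * Uniqueness *)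

Section uniqueness.
Context d (Y : measurableType d) (R : realType) (mu : probability Y R).
Notation lam := (@lebesgue_measure R).
Notation nu := ((lam \x mu)%E : {measure set (measurableTypeR R * Y) -> \bar R}).

(** Only the two equations are almost-everywhere statements. Bounds and measurability hold
    everywhere, so every time section and every space section can be integrated. *)
Definition bounded_solution (q : R -> R) (a : Y -> R) (T N : R) (eta sigma : R * Y -> R) :=
  [/\ measurable_fun setT eta, measurable_fun setT sigma,
      (forall z, `|eta z| <= N), (forall z, `|sigma z| <= N) &
      {ae nu, forall z, 0 <= z.1 <= T ->
        eta z = a z.2 - \int[lam]_(s in `[0, z.1]) (eta (s, z.2) * sigma (s, z.2)) /\
        sigma z = q (eta z) - \int[mu]_y (q (eta (z.1, y)) *
          expR (\int[lam]_(s in `[0, z.1]) sigma (s, y)))}].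

Variables (q : R -> R) (a : Y -> R) (T N k B : R).
Hypotheses (k0 : 0 <= k) (B0 : 0 <= B) (N0 : 0 <= N).
Hypotheses (qL : forall x y, `|q x - q y| <= k * `|x - y|) (qB : forall x, `|q x| <= B).

Let cq : continuous q. Proof. by apply: lipschitz_continuousR => s t; exact: qL. Qed.

Let primitive (sigma : R * Y -> R) (z : R * Y) := \int[lam]_(s in `[0, z.1]) sigma (s, z.2).

Let section_y (f : R * Y -> R) y : measurable_fun setT f ->
  measurable_fun setT (fun s => f (s, y)).
Proof. by move=> mf; exact: (measurableT_comp mf (pair2_measurable y)). Qed.

Let section_t (f : R * Y -> R) t : measurable_fun setT f ->
  measurable_fun setT (fun y => f (t, y)).
Proof. by move=> mf; exact: (measurableT_comp mf (pair1_measurable t)). Qed.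

Let E := expR (N * T).

Let expR_primitive_le (sigma : R * Y -> R) t y : measurable_fun setT sigma ->
  (forall z, `|sigma z| <= N) -> 0 <= t <= T -> `|expR (primitive sigma (t, y))| <= E.
Proof.
move=> ms sN /andP[t0 tT]; apply: (@le_trans _ _ (expR (N * t))).
  apply: expR_bounded; apply: le_normr_time_integral => //; exact: section_y.
by rewrite /E ler_expR ler_wpM2l.
Qed.

Let average (eta sigma : R * Y -> R) t :=
  \int[mu]_y (q (eta (t, y)) * expR (primitive sigma (t, y))).

Let measurable_average (eta sigma : R * Y -> R) t :
  measurable_fun setT eta -> measurable_fun setT sigma ->
  measurable_fun setT (fun y => q (eta (t, y)) * expR (primitive sigma (t, y))).
Proof.
move=> me ms; apply: measurable_funM.
  exact: (measurableT_comp (continuous_measurable_fun cq) (section_t t me)).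
apply: measurableT_comp => //.
exact: (section_t t (measurable_fun_time_integral ms)).
Qed.

(** The summands come from eta, from [q] of eta, and from the mean, where [E] bounds J on [[0, T]].
    The choice of [c] below makes [G / c] at most one half. *)
Let G := 2 * N + k * (2 * N) + E * (k * (2 * N) + 2 * B).
Let c := 2 * (G + 1).

Let E0 : 0 <= E. Proof. exact: expR_ge0. Qed.

Let G0 : 0 <= G.
Proof. by rewrite /G !addr_ge0 ?mulr_ge0 ?addr_ge0 ?mulr_ge0. Qed.

Let c0 : 0 < c. Proof. by rewrite mulr_gt0// ltr_wpDl. Qed.

Section two_solutions.
Variables (eta sigma eta' sigma' : R * Y -> R).
Hypotheses (sol : bounded_solution q a T N eta sigma).
Hypotheses (sol' : bounded_solution q a T N eta' sigma').

Let F := ae_filter_ringOfSetsType nu.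

Let close (A : R) := {ae nu, forall z, 0 <= z.1 <= T ->
  `|eta z - eta' z| <= A * expR (c * z.1) /\ `|sigma z - sigma' z| <= A * expR (c * z.1)}.

(** The equation for [sigma] contains no time integral, so it gains nothing from the weight
    directly. The factor 1/c is gained by eta and by the primitive of [sigma], and is then carried
    to [sigma] through its formula. *)
Let close_step A : 0 <= A -> close A -> close (A / 2).
Proof.
have [me ms eN sN solE] := sol; have [me' ms' eN' sN' solE'] := sol'.
move=> A0 cA.
pose D := A / c; have D0 : 0 <= D by rewrite divr_ge0// ltW.
(* Almost every [y] but every [t]: only time integrals are compared, and these ignore null sets of
   times. *)
have step1 : {ae mu, forall y, forall t, 0 <= t <= T ->
    `|primitive sigma (t, y) - primitive sigma' (t, y)| <= D * expR (c * t) /\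
    `|\int[lam]_(s in `[0, t]) (eta (s, y) * sigma (s, y)) -
      \int[lam]_(s in `[0, t]) (eta' (s, y) * sigma' (s, y))| <=
     2 * N * D * expR (c * t)}.
  apply: filterS (ae_prod_sectiony cA) => y hy t /andP[t0 tT].
  have mse : measurable_fun setT (fun s => eta (s, y)) by exact: section_y.
  have mse' : measurable_fun setT (fun s => eta' (s, y)) by exact: section_y.
  have mss : measurable_fun setT (fun s => sigma (s, y)) by exact: section_y.
  have mss' : measurable_fun setT (fun s => sigma' (s, y)) by exact: section_y.
  have mp : measurable_fun setT (fun s => eta (s, y) * sigma (s, y)) by exact: measurable_funM.
  have mp' : measurable_fun setT (fun s => eta' (s, y) * sigma' (s, y)) by exact: measurable_funM.
  have is1 := @integrable_itv _ 0 t _ N mss (fun s _ => sN (s, y)).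
  have is2 := @integrable_itv _ 0 t _ N mss' (fun s _ => sN' (s, y)).
  have pN s : `|eta (s, y) * sigma (s, y)| <= N * N by rewrite normrM ler_pM.
  have pN' s : `|eta' (s, y) * sigma' (s, y)| <= N * N by rewrite normrM ler_pM.
  have ip1 := @integrable_itv _ 0 t _ (N * N) mp (fun s _ => pN s).
  have ip2 := @integrable_itv _ 0 t _ (N * N) mp' (fun s _ => pN' s).
  split.
    rewrite /primitive /= -RintegralB//.
    apply: le_normr_time_integral_expR => //; first exact: measurable_funB.
    apply: filterS hy => s hs /andP[s0 st]; apply: (hs _).2.
    by rewrite /= s0 (le_trans st).
  rewrite -RintegralB//.
  have -> : 2 * N * D = (2 * N * A) / c by rewrite /D; ring.
  apply: le_normr_time_integral_expR => //.
  - exact: measurable_funB.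
  - by rewrite !mulr_ge0.
  apply: filterS hy => s hs /andP[s0 st].
  have [|/= h1 h2] := hs _; first by rewrite /= s0 (le_trans st).
  rewrite (_ : _ - _ = (eta (s, y) - eta' (s, y)) * sigma (s, y) +
    eta' (s, y) * (sigma (s, y) - sigma' (s, y))); last by ring.
  rewrite (le_trans (ler_normD _ _))// !normrM.
  rewrite (_ : 2 * N * A * _ = (A * expR (c * s)) * N + N * (A * expR (c * s))); last by ring.
  by apply: lerD; apply: ler_pM.
have step2 : {ae nu, forall z, 0 <= z.1 <= T ->
    `|eta z - eta' z| <= 2 * N * D * expR (c * z.1) /\
    `|primitive sigma z - primitive sigma' z| <= D * expR (c * z.1)}.
  apply: (@filterS3 _ _ F) solE solE' (ae_prod2 lam step1) => -[t y] /= h h' hy tT.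
  have [hL hP] := hy _ tT; split => //.
  rewrite (h tT).1 (h' tT).1.
  by rewrite [X in `|X|](_ : _ = - (\int[lam]_(s in `[0, t]) (eta (s, y) * sigma (s, y)) -
      \int[lam]_(s in `[0, t]) (eta' (s, y) * sigma' (s, y)))) ?normrN//; ring.
(* For almost every [t] the exceptional set has a null slice, so the averages over [Y] can be
   compared. *)
have step3 : {ae lam, forall t, 0 <= t <= T ->
    `|average eta sigma t - average eta' sigma' t| <=
    E * (k * (2 * N) + 2 * B) * D * expR (c * t)}.
  apply: filterS (ae_prod_sectionx step2) => t ht tT.
  have bd (e s : R * Y -> R) : measurable_fun setT s -> (forall z, `|s z| <= N) ->
      forall y, `|q (e (t, y)) * expR (primitive s (t, y))| <= B * E.
    by move=> mes esN y; rewrite normrM ler_pM// expR_primitive_le.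
  have m1 := measurable_average t me ms; have m2 := measurable_average t me' ms'.
  rewrite /average -RintegralB//; last 2 first.
  - exact: (integrable_probability mu m1 (bd eta sigma ms sN)).
  - exact: (integrable_probability mu m2 (bd eta' sigma' ms' sN')).
  apply: le_normr_average; first exact: measurable_funB.
  apply: filterS ht => y /(_ tT)[/= he hL].
  rewrite (_ : _ - _ = (q (eta (t, y)) - q (eta' (t, y))) * expR (primitive sigma (t, y)) +
    q (eta' (t, y)) * (expR (primitive sigma (t, y)) - expR (primitive sigma' (t, y)))); last by ring.
  rewrite (le_trans (ler_normD _ _))// !normrM.
  rewrite (_ : E * _ * _ * _ = k * (2 * N * D * expR (c * t)) * E +
     B * (D * expR (c * t) * (E + E))); last by ring.
  have el := expR_primitive_le y ms sN tT; have el' := expR_primitive_le y ms' sN' tT.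
  apply: lerD.
    by apply: ler_pM => //; apply: (le_trans (qL _ _)); exact: ler_wpM2l.
  apply: ler_pM => //; apply: (le_trans (le_expR_dist _ _)); apply: ler_pM => //.
  by rewrite lerD// (le_trans (ler_norm _)).
have GD : G * D <= A / 2.
  rewrite /D mulrA ler_pdivrMr// /c.
  rewrite (_ : A / 2 * (2 * (G + 1)) = G * A + A); last by field.
  by rewrite lerDl.
apply: (@filterS3 _ _ F) (@filterI _ _ F _ _ solE solE') step2 (ae_prod1 mu step3) => -[t y] /= [h h'] h2 h3 tT.
have [he _] := h2 tT; have hA := h3 tT.
have e0 := expR_ge0 (c * t).
have GDe : G * D * expR (c * t) <= A / 2 * expR (c * t) by rewrite ler_wpM2r.
have p1 : 0 <= 2 * N * D * expR (c * t) by rewrite mulr_ge0// mulr_ge0// mulr_ge0.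
have p2 : 0 <= k * (2 * N * D * expR (c * t)) by rewrite mulr_ge0.
have p3 : 0 <= E * (k * (2 * N) + 2 * B) * D * expR (c * t).
  by rewrite mulr_ge0// mulr_ge0// mulr_ge0// addr_ge0// mulr_ge0// mulr_ge0.
have {}GDe : 2 * N * D * expR (c * t) + (k * (2 * N * D * expR (c * t)) +
    E * (k * (2 * N) + 2 * B) * D * expR (c * t)) <= A / 2 * expR (c * t).
  rewrite (_ : _ + _ = G * D * expR (c * t))//.
  by rewrite /G; ring.
split; first by apply: (le_trans he); apply: le_trans GDe; rewrite lerDl addr_ge0.
have sE : sigma (t, y) = q (eta (t, y)) - average eta sigma t := (h tT).2.
have sE' : sigma' (t, y) = q (eta' (t, y)) - average eta' sigma' t := (h' tT).2.
have swap (x u v w : R) : x - u - (v - w) = (x - v) - (u - w) by ring.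
rewrite sE sE' swap; apply: (le_trans (ler_normB _ _)).
apply: le_trans GDe; rewrite -[leLHS]add0r; apply: lerD => //; apply: lerD => //.
by apply: (le_trans (qL _ _)); exact: ler_wpM2l.
Qed.

Lemma bounded_solution_unique : {ae nu, forall z, 0 <= z.1 <= T ->
  eta z = eta' z /\ sigma z = sigma' z}.
Proof.
have [me ms eN sN solE] := sol; have [me' ms' eN' sN' solE'] := sol'.
have cl n : close (2 * N / 2 ^+ n).
  elim: n => [|n IH].
    rewrite expr0 divr1; apply: aeW => z /andP[z0 _].
    have e1 : 1 <= expR (c * z.1).
      by apply: le_trans (expR_ge1Dx _); rewrite lerDl mulr_ge0// ltW.
    have N2 : 2 * N <= 2 * N * expR (c * z.1) by rewrite ler_peMr// mulr_ge0.
    have := eN z; have := eN' z; have := sN z; have := sN' z => *.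
    split; apply: le_trans N2; rewrite (le_trans (ler_normB _ _))//; lra.
  have -> : 2 * N / 2 ^+ n.+1 = 2 * N / 2 ^+ n / 2.
    by rewrite exprS; field; rewrite expf_neq0.
  by apply: close_step => //; rewrite divr_ge0 ?mulr_ge0// exprn_ge0.
apply: (@filterS _ _ F) (ae_foralln cl) => z h zT; split; apply/eqP; rewrite -subr_eq0 -normr_le0;
  apply: (@le0_of_geometric_bound _ _ (2 * N * expR (c * z.1))) => n;
  have [h1 h2] := h n zT; rewrite mulrAC//.
Qed.

End two_solutions.
End uniqueness.

(** * Positivity of solutions *)

Section positivity.
Context (R : realType).
Notation lam := (@lebesgue_measure R).

(* On an interval where [g] is negative and vanishes at the left end [s],
   [g = - \int_s g sigma] forces [g = 0]. *)
Lemma linear_volterra_ge0 (f sigma : R -> R) (a N T : R) :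
  measurable_fun setT f -> measurable_fun setT sigma ->
  (forall t, `|f t| <= N) -> (forall t, `|sigma t| <= N) -> 0 <= a ->
  {ae lam, forall t, 0 <= t <= T -> f t = a - \int[lam]_(s in `[0, t]) (f s * sigma s)} ->
  forall t, 0 <= t <= T -> 0 <= a - \int[lam]_(s in `[0, t]) (f s * sigma s).
Proof.
move=> mf ms fN sN a0 fE t /andP[t0 tT].
have N0 : 0 <= N by exact: le_trans (fN 0).
have mfs : measurable_fun setT (fun s => f s * sigma s) by exact: measurable_funM.
have fsN s : `|f s * sigma s| <= N * N by rewrite normrM ler_pM.
(* The continuous representative of [f]; it solves the same integral equation and admits a crossing
   argument. *)
have [g gE] : exists g : R -> R, forall u, g u = a - \int[lam]_(s in `[0, u]) (f s * sigma s).
  by eexists.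
rewrite -gE leNgt; apply/negP => gt0.
have cg : continuous g.
  apply: (@lipschitz_continuousR _ _ (N * N)) => u v; rewrite !gE.
  rewrite (_ : _ - _ - _ = \int[lam]_(s in `[0, u]) (f s * sigma s) -
    \int[lam]_(s in `[0, v]) (f s * sigma s)); last by ring.
  by rewrite distrC; exact: time_integral_lipschitz.
have g0 : g 0 = a by rewrite gE set_itv1 Rintegral_set1 subr0.
have mg : measurable_fun setT g by exact: continuous_measurable_fun.
have mgs : measurable_fun setT (fun s => g s * sigma s) by exact: measurable_funM.
have gB u : 0 <= u <= t -> `|g u| <= a + N * N * t.
  move=> /andP[u0 ut]; rewrite gE (le_trans (ler_normB _ _))// (ger0_norm a0) lerD2l.
  by rewrite (le_trans (le_normr_time_integral mfs fsN u0))// ler_wpM2l// mulr_ge0.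
have igs u : 0 <= u <= t -> lam.-integrable `[0, u] (EFin \o (fun s => g s * sigma s)).
  move=> /andP[u0 ut]; apply: (@integrable_itv _ _ _ _ ((a + N * N * t) * N)) => // s /andP[s0 su].
  by rewrite normrM ler_pM// gB// s0 (le_trans su).
have gV u : 0 <= u <= t -> g u = a - \int[lam]_(s in `[0, u]) (g s * sigma s).
  move=> /andP[u0 ut]; rewrite gE; congr (_ - fine _).
  case: fE => M [mM M0 fM]; apply: (eq_integral_off_null mM M0) => s.
  rewrite /= in_itv/= => /andP[s0 su] Ms.
  have -> // : f s = g s.
  rewrite gE; apply: contrapT => h; apply: Ms; apply: fM => /= h2; apply: h; apply: h2.
  by rewrite s0 (le_trans su)// (le_trans ut).
have [s [/andP[s0 st] gs after]] :
    exists s, [/\ 0 <= s < t, - g s = 0 & forall u, s < u <= t -> 0 < - g u].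
  apply: last_crossing => //.
  - by move=> u; apply: cvgN; exact: cg.
  - by rewrite g0 oppr_le0.
  - by rewrite oppr_gt0.
have {gs}gs : g s = 0 by apply/eqP; rewrite -oppr_eq0 gs.
(* Since [(N + 1) / c] is one half, each pass through the integral equation halves the bound. *)
pose c := 2 * (N + 1); have c0 : 0 < c by rewrite mulr_gt0// ltr_wpDl.
pose A0 := a + N * N * t; have A00 : 0 <= A0 by rewrite addr_ge0// !mulr_ge0.
have claim n : forall u, s <= u <= t -> `|g u| <= A0 / 2 ^+ n * expR (c * u).
  elim: n => [u /andP[su ut]|n IH u /andP[su ut]].
    have u0 := le_trans s0 su.
    rewrite expr0 divr1 (le_trans (gB u _)) ?u0// ler_peMr//.
    by apply: le_trans (expR_ge1Dx _); rewrite lerDl mulr_ge0// ltW.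
  have u0 := le_trans s0 su.
  (* As [g s = 0], the integral up to [s] cancels [a]. Cutting the integrand to []s, t]] restores an
     integral starting at 0, to which the weighted estimate applies. *)
  pose h := (fun v => g v * sigma v) \_ [set` `]s, t]].
  have mh : measurable_fun setT h.
    by apply/(measurable_restrictT _ (measurable_itv _)); exact: measurable_funTS.
  have guE : g u = - \int[lam]_(v in `[0, u]) h v.
    rewrite -Rintegral_mkcondr.
    have -> : [set` `[0, u]] `&` [set` `]s, t]] = [set` `]s, u]].
      apply/seteqP; split => v /=; rewrite !in_itv/=.
        by move=> [/andP[_ vu] /andP[sv _]]; rewrite sv.
      move=> /andP[sv vu]; rewrite sv vu (le_trans vu ut); split => //.
      by rewrite (le_trans s0)// ltW.
    have ui : 0 <= u <= t by rewrite u0.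
    have si : 0 <= s <= t by rewrite s0 ltW.
    rewrite -(Rintegral_itvB (igs u ui)) ?bnd_simp//.
    have aE : a = \int[lam]_(v in `[0, s]) (g v * sigma v).
      by have := gV s si; rewrite gs => /esym/eqP; rewrite subr_eq0 => /eqP.
    by rewrite opprB -aE; exact: gV.
  rewrite guE normrN.
  have -> : A0 / 2 ^+ n.+1 = (A0 / 2 ^+ n * (N + 1)) / c.
    rewrite exprS /c; field.
    by rewrite expf_neq0// gt_eqF// ltr_wpDl.
  have An : 0 <= A0 / 2 ^+ n by rewrite divr_ge0// exprn_ge0.
  apply: le_normr_time_integral_expR => //.
    by rewrite mulr_ge0// addr_ge0.
  apply: aeW => v _; rewrite /h patchE; case: ifPn => [|_]; last first.
    by rewrite normr0 !mulr_ge0// ?expR_ge0// addr_ge0.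
  rewrite inE/= in_itv/= => /andP[sv vt].
  rewrite normrM mulrAC; apply: ler_pM => //.
    by apply: IH; rewrite vt ltW.
  by rewrite (le_trans (sN v))// lerDl.
have : g t = 0.
  apply/eqP; rewrite -normr_le0.
  apply: (@le0_of_geometric_bound _ _ (A0 * expR (c * t))) => n.
  by have := claim n t; rewrite lexx (ltW st) mulrAC => /(_ isT).
by move=> E; move: gt0; rewrite E ltxx.
Qed.

End positivity.

(** * The torus measure *)

Section torus.
Context {R : realType}.

Lemma measurable_cube n : measurable (cube n : set (n.-tuple R)).
Proof.
rewrite (_ : cube n = \bigcap_(i in [set: 'I_n])
    ((fun y : n.-tuple R => tnth y i) @^-1` [set` `[0, 1]])); last first.
  apply/seteqP; split => y /= h i.
    by move=> _; rewrite /= in_itv/=; exact: h.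
  by have := h i Logic.I; rewrite /= in_itv.
apply: fin_bigcap_measurable => // i _.
by rewrite -[X in measurable X]setTI; exact: measurable_tnth.
Qed.

Lemma torus_measure_setC_cube n : torus_measure n (~` (cube n : set (n.-tuple R))) = 0%E.
Proof.
elim: n => [|n IH] /=.
  by rewrite asboolF// => h; apply: h => -[].
apply: integral0_eq => x; rewrite /= in_itv/= => x01.
rewrite -[RHS]IH; congr (torus_measure n _); apply/seteqP; split => t /= h.
  move=> ht; apply: h => i; have [j ->|->] := unliftP ord0 i.
    by rewrite tnthS; exact: ht.
  by rewrite tnth0.
by move=> hx; apply: h => i; have := hx (lift ord0 i); rewrite tnthS.
Qed.

Section spacetime.
Variables (n : nat) (mu : probability (n.-tuple R) R).
Hypothesis muE : forall A, measurable A -> torus_measure n A = mu A.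
Notation lam := (@lebesgue_measure R).
Notation nu := ((lam \x mu)%E : {measure set (measurableTypeR R * n.-tuple R) -> \bar R}).

Lemma ae_cube : {ae mu, forall y, cube n y}.
Proof.
have mC : measurable (~` cube n : set (n.-tuple R)).
  by apply: measurableC; exact: measurable_cube.
exists (~` cube n); split; [exact: mC| |by []].
rewrite -muE; [exact: torus_measure_setC_cube|exact: mC].
Qed.

Let spacetime_measureE (T : R) (A : set (R * n.-tuple R)) : measurable A ->
  spacetime_measure n T A = nu (A `&` ([set` `[0, T]] `*` setT)).
Proof.
move=> mA; rewrite /spacetime_measure integral_mkcond.
apply: eq_integral => t _; rewrite /= patchE; case: ifPn => tT.
  rewrite muE; last exact: measurable_xsection.
  congr (mu _); apply/seteqP; split => y; rewrite /xsection /= !inE/=.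
    by move=> h; split => //; split => //; rewrite inE in tT.
  by case.
rewrite (_ : xsection _ t = set0) ?measure0//.
apply/seteqP; split => y //; rewrite /xsection /= inE => -[_ [/= h _]].
by move/negP: tT; apply; rewrite inE.
Qed.

Lemma ae_spacetime (T : R) (P : R * n.-tuple R -> Prop) :
  {ae spacetime_measure n T, forall z, P z} <->
  {ae nu, forall z, 0 <= z.1 <= T -> P z}.
Proof.
have mI : measurable ([set` `[0, T]] `*` setT : set (measurableTypeR R * n.-tuple R)).
  by apply: measurableX => //; exact: measurable_itv.
split=> -[A [mA A0 PA]].
  exists (A `&` ([set` `[0, T]] `*` setT)); split.
  - exact: measurableI.
  - by rewrite -spacetime_measureE.
  - move=> z /= /not_implyP[zT nP]; split; first exact: PA.
    by split => //=; rewrite in_itv.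
exists (A `|` ~` ([set` `[0, T]] `*` setT)); split.
- by apply: measurableU => //; exact: measurableC.
- rewrite spacetime_measureE; last by apply: measurableU => //; exact: measurableC.
  rewrite setIUl setICl setU0; apply/eqP; rewrite -measure_le0 -A0.
  by apply: le_measure; rewrite ?inE//; exact: measurableI.
- move=> z /= nP; have [zT|zT] := boolP (0 <= z.1 <= T).
    by left; apply: PA => /= h; apply: nP; exact: h.
  by right => -[/=]; rewrite in_itv/= (negbTE zT).
Qed.

(** The integrand may fail to be measurable, so it is exchanged off a null set; the same null set
    absorbs the complement of the cube. *)
Lemma sigma_avgE (sigma f : R * n.-tuple R -> R) (t : R) (h : n.-tuple R -> R) :
  {ae mu, forall y, f (t, y) * expR (\int[lam]_(s in `[0, t]) sigma (s, y)) = h y} ->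
  sigma_avg sigma f t = \int[mu]_y h y.
Proof.
move=> fh; rewrite /sigma_avg (integral_eq_on_measurable _ _ muE) integral_mkcond.
have [N [mN N0 hN]] := filterI ae_cube fh.
congr fine; apply: (eq_integral_off_null mN N0) => y _ Ny.
have [yc <-] : cube n y /\ f (t, y) * expR (\int[lam]_(s in `[0, t]) sigma (s, y)) = h y.
  by apply: contrapT => H; exact/Ny/hN.
by rewrite patchE mem_set.
Qed.

Variables (p : R -> R) (rho0 a : n.-tuple R -> R).
Hypotheses (rho0a : {ae mu, forall y, rho0 y = a y}) (a0 : forall y, 0 <= a y).

Let F := ae_filter_ringOfSetsType nu.

(** All exceptional sets are merged into one null set [Bd], and both functions are set to 0 there.
    The new density is nonnegative almost everywhere, so [p] may be replaced by its truncation,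
    which is globally Lipschitz. The level [N'] is left free so that two solutions with different
    bounds can share one truncation. *)
Lemma solves_L_bounded_solution (T : R) (eta sigma : R * n.-tuple R -> R) :
  Linf_spacetime T eta -> Linf_spacetime T sigma -> solves_L p rho0 T eta sigma ->
  exists (N : R) (eta1 sigma1 : R * n.-tuple R -> R), 0 <= N /\
    (forall N', N <= N' -> bounded_solution mu (p \o clip N') a T N' eta1 sigma1) /\
    {ae nu, forall z, 0 <= z.1 <= T -> eta z = eta1 z /\ sigma z = sigma1 z}.
Proof.
move=> [me [M1 /ae_spacetime eM]] [ms [M2 /ae_spacetime sM]] /ae_spacetime sol.
pose N := `|M1| + `|M2|; have N0 : 0 <= N by rewrite addr_ge0.
have [Bd [mBd Bd0 HBd]] : {ae nu, forall z, 0 <= z.1 <= T ->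
    [/\ `|eta z| <= N, `|sigma z| <= N, cube n z.2,
      eta z = a z.2 - \int[lam]_(s in `[0, z.1]) (eta (s, z.2) * sigma (s, z.2)) &
      sigma z = p (eta z) - sigma_avg sigma (fun w => p (eta w)) z.1]}.
  apply: (@filterS3 _ _ F) (@filterI _ _ F _ _ eM sM) sol
    (@filterI _ _ F _ _ (ae_prod2 lam ae_cube) (ae_prod2 lam rho0a)).
  move=> z [h1 h2] h3 [h4 h5] zT; split => //.
  - by apply: (le_trans (h1 zT)); apply: (le_trans (ler_norm _)); rewrite lerDl.
  - by apply: (le_trans (h2 zT)); apply: (le_trans (ler_norm _)); rewrite lerDr.
  - by rewrite (h3 zT).1 h5.
  - exact: (h3 zT).2.
have good z : 0 <= z.1 <= T -> ~ Bd z ->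
    [/\ `|eta z| <= N, `|sigma z| <= N, cube n z.2,
      eta z = a z.2 - \int[lam]_(s in `[0, z.1]) (eta (s, z.2) * sigma (s, z.2)) &
      sigma z = p (eta z) - sigma_avg sigma (fun w => p (eta w)) z.1].
  by move=> zT zB; apply: contrapT => h; apply/zB/HBd => /= h2; exact: h (h2 zT).
have aeB : {ae nu, forall z, ~ Bd z}.
  by exists Bd; split => // z /= /contrapT.
pose IC : set (R * n.-tuple R) := [set` `[0, T]] `*` cube n.
have mIC : measurable IC.
  by apply: measurableX; [exact: measurable_itv|exact: measurable_cube].
pose D := IC `\` Bd.
have mD : measurable D by exact: measurableD.
have DT z : D z -> 0 <= z.1 <= T by move=> [[/= + _] _]; rewrite in_itv.
have cut f : measurable_fun IC f -> exists f1 : R * n.-tuple R -> R,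
    [/\ measurable_fun setT f1, (forall z, D z -> f1 z = f z) & (forall z, ~ D z -> f1 z = 0)].
  move=> mf; exists (f \_ D); split.
  - apply/(measurable_restrictT _ mD); apply: measurable_funS mf => //.
    exact: subDsetl.
  - by move=> z Dz; rewrite patchE mem_set.
  - by move=> z Dz; rewrite patchE memNset.
have [eta1 [me1 eD eND]] := cut eta me.
have [sigma1 [ms1 sD sND]] := cut sigma ms.
have inD z : 0 <= z.1 <= T -> ~ Bd z -> D z.
  by move=> zT zB; have [_ _ zc _ _] := good z zT zB; split => //; split => //=; rewrite in_itv.
have e1N z : `|eta1 z| <= N.
  have [Dz|Dz] := pselect (D z); last by rewrite eND// normr0.
  by rewrite eD//; have [] := good z (DT z Dz) Dz.2.
have s1N z : `|sigma1 z| <= N.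
  have [Dz|Dz] := pselect (D z); last by rewrite sND// normr0.
  by rewrite sD//; have [] := good z (DT z Dz) Dz.2.
have eqE : {ae nu, forall z, 0 <= z.1 <= T -> eta z = eta1 z /\ sigma z = sigma1 z}.
  apply: (@filterS _ _ F) aeB => z zB zT.
  by have Dz := inD z zT zB; rewrite eD// sD.
have Hy : {ae mu, forall y, forall t, 0 <= t <= T ->
    \int[lam]_(s in `[0, t]) (eta (s, y) * sigma (s, y)) =
    \int[lam]_(s in `[0, t]) (eta1 (s, y) * sigma1 (s, y)) /\
    \int[lam]_(s in `[0, t]) sigma (s, y) = \int[lam]_(s in `[0, t]) sigma1 (s, y)}.
  apply: filterS (ae_prod_sectiony aeB) => y [M [mM M0 hM]] t /andP[t0 tT].
  have off s : [set` `[0, t]] s -> ~ M s -> D (s, y).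
    rewrite /= in_itv/= => /andP[s0 st] Ms; apply: inD.
      by rewrite /= s0 (le_trans st).
    by apply: contrapT => h; apply: Ms; apply: hM.
  split; congr fine; apply: (eq_integral_off_null mM M0) => s sT Ms;
    have Ds := off s sT Ms; rewrite ?eD// sD//.
have E2 : {ae nu, forall z, 0 <= z.1 <= T ->
    eta1 z = a z.2 - \int[lam]_(s in `[0, z.1]) (eta1 (s, z.2) * sigma1 (s, z.2))}.
  apply: (@filterS2 _ _ F) aeB (ae_prod2 lam Hy) => z zB hy zT.
  have [_ _ _ h _] := good z zT zB.
  by rewrite eD ?h ?(hy _ zT).1//; exact: inD.
(* Positivity is obtained for the right-hand side of the integral equation, line by line in time,
   and then passes to [eta1] almost everywhere. *)
have pos : {ae mu, forall y, forall t, 0 <= t <= T ->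
    0 <= a y - \int[lam]_(s in `[0, t]) (eta1 (s, y) * sigma1 (s, y))}.
  apply: filterS (ae_prod_sectiony E2) => y hy.
  apply: (@linear_volterra_ge0 _ (fun s => eta1 (s, y)) (fun s => sigma1 (s, y)) (a y) N) => //.
  - exact: (measurableT_comp me1 (pair2_measurable y)).
  - exact: (measurableT_comp ms1 (pair2_measurable y)).
have E3 : {ae nu, forall z, 0 <= z.1 <= T -> 0 <= eta1 z}.
  apply: (@filterS2 _ _ F) E2 (ae_prod2 lam pos) => z h hy zT.
  by rewrite h//; exact: hy.
exists N, eta1, sigma1; split => //; split => // N' NN'.
have N'0 : 0 <= N' by exact: le_trans NN'.
(* Positivity is needed on almost every slice: only there does [p] agree with its truncation under
   the average. *)
have avgE : {ae lam, forall t, 0 <= t <= T ->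
    sigma_avg sigma (fun w => p (eta w)) t = \int[mu]_y ((p \o clip N') (eta1 (t, y)) *
          expR (\int[lam]_(s in `[0, t]) sigma1 (s, y)))}.
  apply: filterS2 (ae_prod_sectionx aeB) (ae_prod_sectionx E3) => t hB hp tT.
  apply: sigma_avgE; apply: filterS3 hB hp Hy => y yB yp hy.
  rewrite (hy _ tT).2 /= -(eD _ (inD (t, y) tT yB)) clip_id//.
  by rewrite (yp tT)/= (le_trans (ler_norm _))// (le_trans (e1N _)).
split => //.
- by move=> z; exact: le_trans (e1N z) NN'.
- by move=> z; exact: le_trans (s1N z) NN'.
apply: (@filterS3 _ _ F) (@filterI _ _ F _ _ aeB E2) E3 (ae_prod1 mu avgE).
move=> z [zB h2] h3 h4 zT; split; first exact: h2.
have Dz := inD z zT zB; have [_ _ _ _ hs] := good z zT zB.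
rewrite sD// hs (h4 zT) -(eD z Dz) /= clip_id// (h3 zT)/=.
by rewrite (le_trans (ler_norm _))// (le_trans (e1N _)).
Qed.

End spacetime.
End torus.

Theorem theorem2 (R : realType) (d : nat) (p : R -> R) (rho0 : d.-tuple R -> R) :
  Hp p ->
  Linf_torus rho0 ->
  {ae torus_measure d, forall y, 0 <= rho0 y} ->
  exists r : R, forall T : R, 0 < T ->
    (exists eta sigma : R * d.-tuple R -> R,
        Linf_spacetime T eta /\ Linf_spacetime T sigma /\
        solves_L p rho0 T eta sigma /\
        {ae spacetime_measure d T, forall z, `|eta z| <= r}) /\
    (forall eta sigma eta' sigma' : R * d.-tuple R -> R,
        Linf_spacetime T eta -> Linf_spacetime T sigma ->
        solves_L p rho0 T eta sigma ->
        Linf_spacetime T eta' -> Linf_spacetime T sigma' ->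
        solves_L p rho0 T eta' sigma' ->
        {ae spacetime_measure d T, forall z, eta z = eta' z /\ sigma z = sigma' z}).
Proof.
move=> hp [mrho [M rhoM]] rho_ge0.
have [mu muE] := @torus_measure_probability R d.
pose nu : {measure set (measurableTypeR R * d.-tuple R) -> \bar R} :=
  ((@lebesgue_measure R) \x mu)%E.
pose F := ae_filter_ringOfSetsType nu.
have [Bd [mBd Bd0 HBd]] : {ae mu, forall y, `|rho0 y| <= M /\ 0 <= rho0 y}.
  by apply: filterI; apply/(ae_eq_on_measurable _ muE).
have good y : ~ Bd y -> `|rho0 y| <= M /\ 0 <= rho0 y.
  by move=> yB; apply: contrapT => h; exact/yB/HBd.
pose D := cube d `\` Bd.
have mD : measurable D by apply: measurableD => //; exact: measurable_cube.
(* A representative of [rho0] that is measurable, nonnegative and bounded at every point, so that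
   the flow can be built for each [y]. *)
have [a aD aND] : exists2 a : d.-tuple R -> R, (forall y, D y -> a y = rho0 y) /\ measurable_fun setT a
    & forall y, ~ D y -> a y = 0.
  exists (rho0 \_ D); last by move=> y Dy; rewrite patchE memNset.
  split; first by move=> y Dy; rewrite patchE mem_set.
  apply/(measurable_restrictT _ mD); apply: measurable_funS mrho; last exact: subDsetl.
  exact: measurable_cube.
have ma := aD.2.
have aM y : 0 <= a y <= `|M|.
  have [Dy|Dy] := pselect (D y); last by rewrite aND// lexx normr_ge0.
  have [h1 h2] := good y Dy.2; rewrite aD.1// h2/=.
  by rewrite (le_trans (ler_norm _))// (le_trans h1)// ler_norm.
have rho0a : {ae mu, forall y, rho0 y = a y}.
  have aeB : {ae mu, forall y, ~ Bd y} by exists Bd; split => // y /= /contrapT.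
  by apply: filterS2 (ae_cube muE) aeB => y yc yB; rewrite aD.1.
have [r [r0 [q [l [m [B [[cq qp ml cm [qB mB]] [etar mE lE etaE]]]]]]]] :=
  lagrangian_exists mu hp ma aM (normr_ge0 M).
exists r => T T0; split.
- pose eta (z : R * d.-tuple R) := a z.2 * expR (- l z).
  pose sigma (z : R * d.-tuple R) := q (eta z) - m z.1.
  have meta : measurable_fun setT eta.
    apply: measurable_funM; first by apply: (measurableT_comp ma); exact: measurable_snd.
    by apply: measurableT_comp => //; exact: measurable_funN.
  have msigma : measurable_fun setT sigma.
    apply: measurable_funB.
      exact: (measurableT_comp (continuous_measurable_fun cq) meta).
    exact: (measurableT_comp (continuous_measurable_fun cm) measurable_fst).
  have etaN : {ae spacetime_measure d T, forall z, `|eta z| <= r}.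
    apply/(ae_spacetime muE); apply: aeW => -[t y] /= /andP[t0 tT].
    by have /andP[e0 er] := etar t y t0; rewrite ger0_norm.
  exists eta, sigma; split; [|split; [|split]] => //.
  + by split; [exact: measurable_funTS|exists r].
  + split; first exact: measurable_funTS.
    exists (B + B); apply/(ae_spacetime muE); apply: aeW => z _.
    by rewrite /sigma (le_trans (ler_normB _ _))// lerD.
  apply/(ae_spacetime muE).
  apply: (@filterS _ _ F) (ae_prod2 (@lebesgue_measure R) rho0a) => -[t y] /= ya /andP[t0 tT].
  split; first by rewrite ya; exact: etaE.
  rewrite /sigma /= qp; last exact: etar.
  congr (_ - _); rewrite mE; apply/esym.
  apply: (sigma_avgE muE); apply: aeW => u.
  by rewrite -lE// -qp//; exact: etar.
move=> eta sigma eta' sigma' e1 s1 sol1 e2 s2 sol2; apply/(ae_spacetime muE).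
have a0 y : 0 <= a y by have /andP[] := aM y.
have [N1 [f1 [g1 [N10 [b1 eq1]]]]] := solves_L_bounded_solution muE rho0a a0 e1 s1 sol1.
have [N2 [f2 [g2 [N20 [b2 eq2]]]]] := solves_L_bounded_solution muE rho0a a0 e2 s2 sol2.
(* A common level: both pairs then solve the same truncated system. *)
pose N := Num.max N1 N2; have N0 : 0 <= N by rewrite le_max N10.
have [k [k0 [kP _]]] := clip_pressure_lipschitz N0 hp.
have [C [C0 CP]] := clip_pressure_bounded N0 hp.
have b1N := b1 N; have b2N := b2 N.
have un := bounded_solution_unique (ltW k0) C0 N0 kP CP
  (b1N ltac:(by rewrite le_max lexx)) (b2N ltac:(by rewrite le_max lexx orbT)).
apply: (@filterS3 _ _ F) eq1 eq2 un => z h1 h2 h3 zT.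
have [-> ->] := h1 zT; have [-> ->] := h2 zT; exact: h3.
Qed.
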